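(* Let $\Gamma=(S,E)$ be a finite graph, $U$ a topological group, $\mathcal{O}\le U$ an open subgroup and $\varphi\colon\mathcal{O}\hookrightarrow U$ a continuous open monomorphism. The natural action of $\mathcal{A}_\Gamma(\varphi)$ on the vertex set of $\widetilde{S}_\Gamma(\varphi)$ by left multiplication extends to an action by isometries on the whole of $\widetilde{S}_\Gamma(\varphi)$. In particular, the following properties hold. (1) For every $T\subseteq S$ that is empty or spans a clique in $\Gamma$, $\mathcal{A}_\Gamma(\varphi)$ acts transitively on the cubes of $\widetilde{S}_\Gamma(\varphi)$ of type $T$. In particular, $\mathcal{A}_\Gamma(\varphi)$ acts cocompactly on $\widetilde{S}_\Gamma(\varphi)$. (2) For all $g\in\mathcal{A}_\Gamma(\varphi)$, the stabiliser of the vertex $gU$ is $gUg^{-1}$. In particular it is topologically isomorphic to $U$. (3) For every $T\subseteq S$ spanning a clique in $\Gamma$ with $|T|=k\ge1$ and every $g\in\mathcal{A}_\Gamma(\varphi)$, the pointwise stabiliser of the $k$-cell $gQ_T$ satisfies $\mathrm{stab}_{\mathcal{A}_\Gamma(\varphi)}(gQ_T)=g\cdot\mathrm{stab}_{\mathcal{A}_\Gamma(\varphi)}(Q_T)\cdot g^{-1}$. Additionally, if $\varphi(\mathcal{O})\subseteq\mathcal{O}$, then $\mathrm{stab}_{\mathcal{A}_\Gamma(\varphi)}(gQ_T)=g\cdot\varphi^k(\mathcal{O})\cdot g^{-1}$, in which case it is topologically isomorphic to $\mathcal{O}$.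
   Context: All topological groups are Hausdorff; graphs are simplicial with non-empty vertex set. A continuous open monomorphism is an injective group homomorphism that is continuous and open. Topological RAAG: put $\mathcal{H}_S(\varphi)=(U*F(S))/\langle\langle t\omega t^{-1}\varphi(\omega)^{-1}\mid t\in S,\omega\in\mathcal{O}\rangle\rangle$, with the unique group topology making the canonical embedding $U\hookrightarrow\mathcal{H}_S(\varphi)$ continuous and open; $\mathcal{A}_\Gamma(\varphi)=\mathcal{H}_S(\varphi)/\langle\langle sts^{-1}t^{-1}\mid\{s,t\}\in E\rangle\rangle$ with the quotient topology. The canonical map $U\to\mathcal{A}_\Gamma(\varphi)$ is injective with open image, and $U$ is identified with its image. Generalised universal Salvetti complex $\widetilde{S}_\Gamma(\varphi)$: vertices are the cosets $gU$, $g\in\mathcal{A}_\Gamma(\varphi)$. For each $g$ and each $T=\{t_1,\dots,t_k\}\subseteq S$ that is empty or spans a clique of $\Gamma$, there is a $k$-dimensional Euclidean unit cube $gQ_T$ (said to be of type $T$; $1Q_T$ is written $Q_T$, and $gQ_\varnothing=gU$) with vertex set $\{gt_1^{\varepsilon_1}\cdots t_k^{\varepsilon_k}U\mid\varepsilon_i\in\{0,1\}\}$, the vertex indexed by $\varepsilon$ corresponding to $\varepsilon\in[0,1]^k$; faces are the corresponding lower-dimensional cubes of this kind, and a cell is determined by its vertex set. It carries the piecewise Euclidean length metric. *)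

(* Defs.v *)
From HB Require Import structures.
From Stdlib Require Import Relation_Operators.
From mathcomp Require Import all_boot all_order all_algebra.
From mathcomp Require Import all_classical all_reals all_analysis.
Set Implicit Arguments.
Unset Strict Implicit.
Unset Printing Implicit Defensive.
Import Order.TTheory GRing.Theory Num.Theory.
Local Open Scope classical_set_scope.
Local Open Scope group_scope.

Section GenQuot.
Variables (T : choiceType) (r : T -> T -> Prop).

Let e0 : rel T := fun x y => `[< clos_refl_sym_trans T r x y >].

Fact gen_equiv_refl : reflexive e0.
Proof. by move=> x; apply/asboolP; exact: rst_refl. Qed.
Fact gen_equiv_sym : symmetric e0.
Proof. by move=> x y; apply/asboolP/asboolP; exact: rst_sym. Qed.
Fact gen_equiv_trans : transitive e0.
Proof. by move=> y x z /asboolP xy /asboolP yz; apply/asboolP; exact: rst_trans yz. Qed.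

Definition gen_equiv : equiv_rel T :=
  EquivRel e0 gen_equiv_refl gen_equiv_sym gen_equiv_trans.

Definition genquot : Type := {eq_quot gen_equiv}%qT.
HB.instance Definition _ := Choice.on genquot.

Definition cls (x : T) : genquot := (\pi_({eq_quot gen_equiv}%qT) x)%qT.
Definition cls_repr (c : genquot) : T := repr (c : {eq_quot gen_equiv}%qT).

Lemma cls_reprK c : cls (cls_repr c) = c.
Proof. exact: reprK. Qed.

Lemma clsP x y : cls x = cls y <-> clos_refl_sym_trans T r x y.
Proof.
split=> [/eqmodP/asboolP//|xy]; exact/eqmodP/asboolP.
Qed.

Lemma cls_ind (P : genquot -> Prop) : (forall x, P (cls x)) -> forall c, P c.
Proof. by move=> h c; rewrite -(cls_reprK c). Qed.

End GenQuot.

(* Words in the letters [X] modulo the congruence generated by the pairs in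
   [rel] and by [x (inv x) = (inv x) x = 1]. *)
Section WordGroup.
Variables (X : choiceType) (inv : X -> X) (rel : seq X -> seq X -> Prop).

Inductive word_rel : seq X -> seq X -> Prop :=
| word_relR a b of rel a b : word_rel a b
| word_relV x : word_rel [:: x; inv x] [::]
| word_relVr x : word_rel [:: inv x; x] [::].

Inductive word_step : seq X -> seq X -> Prop :=
| WordStep u v a b of word_rel a b : word_step (u ++ a ++ v) (u ++ b ++ v).

Definition word_group : Type := genquot word_step.
HB.instance Definition _ := Choice.on word_group.

Definition word (w : seq X) : word_group := cls word_step w.
Let wequiv := clos_refl_sym_trans (seq X) word_step.

Let wequiv_cat u v a b : wequiv a b -> wequiv (u ++ a ++ v) (u ++ b ++ v).
Proof.
elim=> {a b} [_ _ [u' v' a b ab]|a|a b _|a b c _ ab _ bc].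
- by apply: rst_step; have := WordStep (u ++ u') (v' ++ v) ab; rewrite -!catA.
- exact: rst_refl.
- exact: rst_sym.
- exact: rst_trans bc.
Qed.

Let wequivM a a' b b' : wequiv a a' -> wequiv b b' -> wequiv (a ++ b) (a' ++ b').
Proof.
move=> aa bb; apply: (@rst_trans _ _ _ (a' ++ b)).
  exact: (@wequiv_cat [::] b).
by move: (@wequiv_cat a' [::] _ _ bb); rewrite !cats0.
Qed.

Let winv (w : seq X) := rev (map inv w).

Let wequivVr w : wequiv (winv w ++ w) [::].
Proof.
elim: w => [|x w ih]; first exact: rst_refl.
rewrite /winv /= rev_cons cat_rcons; apply: rst_trans ih.
by apply: rst_step; apply: (@WordStep _ w [:: inv x; x] [::]); exact: word_relVr.
Qed.

Let wequivV w : wequiv (w ++ winv w) [::].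
Proof.
elim: w => [|x w ih]; first exact: rst_refl.
rewrite /winv /= rev_cons -cats1 catA -[x :: _]/([:: x] ++ _).
apply: (@rst_trans _ _ _ ([:: x] ++ [::] ++ [:: inv x])); first exact: wequiv_cat.
by apply: rst_step; apply: (@WordStep [::] [::] [:: x; inv x] [::]); exact: word_relV.
Qed.

Let wmul (c d : word_group) : word_group := word (cls_repr c ++ cls_repr d).
Let wone : word_group := word [::].
Let wginv (c : word_group) : word_group := word (winv (cls_repr c)).

Let repr_word w : wequiv (cls_repr (word w)) w.
Proof. by apply/clsP; rewrite cls_reprK. Qed.

Let wmulE a b : wmul (word a) (word b) = word (a ++ b).
Proof. by apply/clsP; exact: wequivM. Qed.

Let word_ind (P : word_group -> Prop) : (forall w, P (word w)) -> forall c, P c.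
Proof. exact: cls_ind. Qed.

Let wequivVr' a : wequiv (winv (cls_repr (word a)) ++ a) [::].
Proof.
apply: (@rst_trans _ _ _ _ _ _ (wequivVr (cls_repr (word a)))).
by apply: wequivM; [exact: rst_refl|exact/rst_sym/repr_word].
Qed.

Let wequivV' a : wequiv (a ++ winv (cls_repr (word a))) [::].
Proof.
apply: (@rst_trans _ _ _ _ _ _ (wequivV (cls_repr (word a)))).
by apply: wequivM; [exact/rst_sym/repr_word|exact: rst_refl].
Qed.

Let wmulA : associative wmul.
Proof.
by elim/word_ind => a; elim/word_ind => b; elim/word_ind => c; rewrite !wmulE catA.
Qed.
Let wmul1 : left_id wone wmul.
Proof. by elim/word_ind => a; rewrite wmulE. Qed.
Let wmulr1 : right_id wone wmul.
Proof. by elim/word_ind => a; rewrite wmulE cats0. Qed.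
Let wmulV : left_inverse wone wginv wmul.
Proof. by elim/word_ind => a; rewrite wmulE; apply/clsP; exact: wequivVr'. Qed.
Let wmulVr : right_inverse wone wginv wmul.
Proof. by elim/word_ind => a; rewrite wmulE; apply/clsP; exact: wequivV'. Qed.

HB.instance Definition _ :=
  isGroup.Build word_group wmulA wmul1 wmulr1 wmulV wmulVr.

Definition letter (x : X) : word_group := word [:: x].

Lemma word_mulE a b : word a * word b = word (a ++ b).
Proof. exact: wmulE. Qed.

Lemma letter_ind (P : word_group -> Prop) :
  P 1 -> (forall x w, P w -> P (letter x * w)) -> forall w, P w.
Proof.
move=> P1 PM; elim/word_ind; elim=> [//|x w ih].
by rewrite -[word _](wmulE [:: x] w); exact: PM.
Qed.

Lemma word_relE a b : word_rel a b -> word a = word b.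
Proof.
move=> ab; apply/clsP/rst_step.
by have := @WordStep [::] [::] _ _ ab; rewrite /= !cats0.
Qed.

Lemma letterV x : letter (inv x) = (letter x)^-1.
Proof.
apply/esym; apply: mulg1_eq; rewrite [LHS]wmulE; exact/word_relE/word_relV.
Qed.

End WordGroup.
Arguments word {X} inv rel w.
Arguments letter {X} inv rel x.

Section FreeGroup.
Variable S : choiceType.

(* [(s, true)] stands for [s] and [(s, false)] for its formal inverse. *)
Definition free_group : Type :=
  @word_group (S * bool)%type (fun x => (x.1, ~~ x.2)) (fun _ _ => False).
HB.instance Definition _ := Group.on free_group.

Definition free_gen (s : S) : free_group := letter _ _ (s, true).

Lemma free_group_ind (P : free_group -> Prop) :
  P 1 -> (forall s w, P w -> P (free_gen s * w)) ->
  (forall s w, P w -> P ((free_gen s)^-1 * w)) -> forall w, P w.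
Proof.
move=> P1 Pg PV; apply: letter_ind => // -[s []] w Pw; first exact: Pg.
by have := PV s w Pw; rewrite /free_gen -letterV.
Qed.

End FreeGroup.

Section FreeProduct.
Variables G H : groupType.

Inductive free_prod_rel : seq (G + H) -> seq (G + H) -> Prop :=
| free_prod_rel1l : free_prod_rel [:: inl 1] [::]
| free_prod_rel1r : free_prod_rel [:: inr 1] [::]
| free_prod_relMl x y : free_prod_rel [:: inl x; inl y] [:: inl (x * y)]
| free_prod_relMr x y : free_prod_rel [:: inr x; inr y] [:: inr (x * y)].

Definition free_prod : Type :=
  @word_group (G + H)%type
    (fun x => match x with inl g => inl g^-1 | inr h => inr h^-1 end)
    free_prod_rel.
HB.instance Definition _ := Group.on free_prod.

Definition free_inl (g : G) : free_prod := letter _ _ (inl g).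
Definition free_inr (h : H) : free_prod := letter _ _ (inr h).

Lemma free_inlM x y : free_inl (x * y) = free_inl x * free_inl y.
Proof.
rewrite [RHS](word_mulE _ _ [:: inl x]); apply/esym.
by apply: word_relE; apply: word_relR; exact: free_prod_relMl.
Qed.

Lemma free_inrM x y : free_inr (x * y) = free_inr x * free_inr y.
Proof.
rewrite [RHS](word_mulE _ _ [:: inr x]); apply/esym.
by apply: word_relE; apply: word_relR; exact: free_prod_relMr.
Qed.

Lemma free_prod_ind (P : free_prod -> Prop) :
  P 1 -> (forall g w, P w -> P (free_inl g * w)) ->
  (forall h w, P w -> P (free_inr h * w)) -> forall w, P w.
Proof. by move=> P1 Pg Ph; apply: letter_ind => // -[g|h]; [exact: Pg|exact: Ph]. Qed.

End FreeProduct.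

Definition is_normal_subgroup (G : groupType) (N : set G) : Prop :=
  [/\ N 1, (forall x y, N x -> N y -> N (x * y)), (forall x, N x -> N x^-1)
    & forall x y, N x -> N (x ^ y)].

Definition normal_closure (G : groupType) (X : set G) : set G :=
  \bigcap_(N in [set N | is_normal_subgroup N /\ X `<=` N]) N.

Lemma normal_closure_normal (G : groupType) (X : set G) :
  is_normal_subgroup (normal_closure X).
Proof.
split=> [N [[]]//|x y Nx Ny N NX|x Nx N NX|x y Nx N NX].
- by have [[_ M _ _] _] := NX; apply: M; [exact: Nx|exact: Ny].
- by have [[_ _ V _] _] := NX; apply: V; exact: Nx.
- by have [[_ _ _ J] _] := NX; apply: J; exact: Nx.
Qed.

Section QuotientGroup.
Variables (G : groupType) (X : set G).
Let N := normal_closure X.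

(* The relation is already an equivalence relation; see [qprojP]. *)
Definition quotient_group : Type := genquot (fun x y : G => N (x^-1 * y)).
HB.instance Definition _ := Choice.on quotient_group.

Definition qproj (x : G) : quotient_group := cls _ x.

Lemma qprojP x y : qproj x = qproj y <-> N (x^-1 * y).
Proof.
have [N1 NM NV _] := normal_closure_normal X.
split=> [/clsP|Nxy]; last exact/clsP/rst_step.
elim=> {x y} [//|x|x y _|x y z _ xy _ yz].
- by rewrite mulVg.
- by move/NV; rewrite invgM invgK.
- by have := NM _ _ xy yz; rewrite -mulgA mulVKg.
Qed.

Let qmul (c d : quotient_group) : quotient_group := qproj (cls_repr c * cls_repr d).
Let qone : quotient_group := qproj 1.
Let qinv (c : quotient_group) : quotient_group := qproj (cls_repr c)^-1.

Let qreprK c : qproj (cls_repr c) = c.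
Proof. exact: cls_reprK. Qed.

Let qmulE x y : qmul (qproj x) (qproj y) = qproj (x * y).
Proof.
have [N1 NM NV NJ] := normal_closure_normal X.
have Nr z : N ((cls_repr (qproj z))^-1 * z) by apply/qprojP; rewrite qreprK.
apply/qprojP; rewrite invgM.
have := NM _ _ (NJ _ (cls_repr (qproj y)) (Nr x)) (Nr y).
by rewrite /conjg !mulgA mulgK.
Qed.

Lemma qproj_ind (P : quotient_group -> Prop) : (forall x, P (qproj x)) -> forall c, P c.
Proof. exact: cls_ind. Qed.

Let qmulA : associative qmul.
Proof.
by elim/qproj_ind => a; elim/qproj_ind => b; elim/qproj_ind => c; rewrite !qmulE mulgA.
Qed.
Let qmul1 : left_id qone qmul.
Proof. by elim/qproj_ind => a; rewrite qmulE mul1g. Qed.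
Let qmulr1 : right_id qone qmul.
Proof. by elim/qproj_ind => a; rewrite qmulE mulg1. Qed.
Let qmulV : left_inverse qone qinv qmul.
Proof.
by move=> c; have := qmulE (cls_repr c)^-1 (cls_repr c); rewrite mulVg qreprK.
Qed.
Let qmulVr : right_inverse qone qinv qmul.
Proof.
by move=> c; have := qmulE (cls_repr c) (cls_repr c)^-1; rewrite mulgV qreprK.
Qed.

HB.instance Definition _ :=
  isGroup.Build quotient_group qmulA qmul1 qmulr1 qmulV qmulVr.

Lemma qprojM x y : qproj (x * y) = qproj x * qproj y.
Proof. exact/esym/qmulE. Qed.

HB.instance Definition _ :=
  isUMagmaMorphism.Build G quotient_group qproj (erefl, qprojM).

Lemma qproj_rel x : X x -> qproj x = 1.
Proof.
move=> Xx; apply/esym/qprojP; rewrite invg1 mul1g => M [_]; exact.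
Qed.

End QuotientGroup.
Arguments qproj {G} X x.

#[short(type="preTopologicalGroupType")]
HB.structure Definition PreTopologicalGroup := {G of Topological G & Group G}.

HB.mixin Record PreTopologicalGroup_isTopologicalGroup G of PreTopologicalGroup G := {
  mulg_continuous : continuous (fun z : G * G => z.1 * z.2);
  invg_continuous : continuous (fun x : G => x^-1)
}.

(* Hausdorffness is not part of the structure. *)
#[short(type="topologicalGroupType")]
HB.structure Definition TopologicalGroup :=
  {G of PreTopologicalGroup G & PreTopologicalGroup_isTopologicalGroup G}.

Section TopologicalGroupTheory.
Variable G : topologicalGroupType.

Lemma lmulg_continuous (x : G) : continuous ( *%g x : G -> G).
Proof.
move=> y; apply: (@continuous_comp _ _ _ (fun y : G => (x, y)) (fun z : G * G => z.1 * z.2)).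
  by apply: cvg_pair; [exact: cvg_cst|exact: cvg_id].
exact: mulg_continuous.
Qed.

Lemma rmulg_continuous (x : G) : continuous (fun y : G => y * x).
Proof.
move=> y; apply: (@continuous_comp _ _ _ (fun y : G => (y, x)) (fun z : G * G => z.1 * z.2)).
  by apply: cvg_pair; [exact: cvg_id|exact: cvg_cst].
exact: mulg_continuous.
Qed.

Lemma open_lmulg (x : G) (V : set G) : open V -> open ( *%g x @` V).
Proof.
move=> oV; have -> : *%g x @` V = *%g x^-1 @^-1` V.
  apply/seteqP; split=> [_ [y Vy <-]|y Vy] /=; first by rewrite mulKg.
  by exists (x^-1 * y) => //; rewrite mulVKg.
by apply: open_comp => // y _; exact: lmulg_continuous.
Qed.

End TopologicalGroupTheory.

(* [tau] is the family of open sets of a group topology on [G]. *)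
Definition is_group_topology (G : groupType) (tau : set (set G)) : Prop :=
  [/\ tau setT, (forall V W, tau V -> tau W -> tau (V `&` W)),
      (forall (I : Type) (V : I -> set G), (forall i, tau (V i)) -> tau (\bigcup_i V i)),
      (forall W x y, tau W -> W (x * y) -> exists V V', [/\ tau V, tau V', V x, V' y
         & forall v v', V v -> V' v' -> W (v * v')])
    & forall W, tau W -> tau [set x | W x^-1]].

(* [K1] and [K2], with the subspace topologies, are isomorphic as topological groups. *)
Definition top_isomorphic (G1 G2 : topologicalGroupType) (K1 : set G1) (K2 : set G2) :
  Prop :=
  exists (f : G1 -> G2) (f' : G2 -> G1),
    [/\ [/\ set_fun K1 K2 f, set_fun K2 K1 f',
            (forall x, K1 x -> f' (f x) = x) & (forall y, K2 y -> f (f' y) = y)],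
        (forall x y, K1 x -> K1 y -> f (x * y) = f x * f y),
        {within K1, continuous f} & {within K2, continuous f'}].

Record openSubgroup (U : topologicalGroupType) := OpenSubgroup {
  osubg_set :> set U;
  osubg_open : open osubg_set;
  osubg1 : osubg_set 1;
  osubgM : forall x y, osubg_set x -> osubg_set y -> osubg_set (x * y);
  osubgV : forall x, osubg_set x -> osubg_set x^-1
}.

(* A continuous open monomorphism [O -> U], as a function on [U] of which only the
   values on [O] matter. *)
Record openMono (U : topologicalGroupType) (O : openSubgroup U) := OpenMono {
  omono_fun :> U -> U;
  omonoM : forall x y, (O : set U) x -> (O : set U) y ->
    omono_fun (x * y) = omono_fun x * omono_fun y;
  omono_inj : forall x y, (O : set U) x -> (O : set U) y -> omono_fun x = omono_fun y -> x = y;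
  omono_continuous : {within O, continuous omono_fun};
  omono_open : forall V, open V -> V `<=` O -> open (omono_fun @` V)
}.

Section HNN.
Variables (S : finType) (U : topologicalGroupType) (O : openSubgroup U)
  (phi : openMono O).

Definition hnn_relators : set (free_prod U (free_group S)) :=
  [set r | exists t w, (O : set U) w /\
     r = free_inr U (free_gen t) * free_inl _ w * (free_inr U (free_gen t))^-1
         * (free_inl _ (phi w))^-1].

Definition hnn : Type := quotient_group hnn_relators.
HB.instance Definition _ := Group.on hnn.

Definition hnn_base (u : U) : hnn := qproj hnn_relators (free_inl _ u).
Definition hnn_gen (s : S) : hnn := qproj hnn_relators (free_inr _ (free_gen s)).

Lemma hnn_baseM : {morph hnn_base : u v / u * v}.
Proof. by move=> u v; rewrite /hnn_base free_inlM; exact: qprojM. Qed.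
HB.instance Definition _ := isMultiplicative.Build U hnn hnn_base hnn_baseM.
Lemma hnn_base1 : hnn_base 1 = 1.
Proof. by apply: (@mulgI _ (hnn_base 1)); rewrite -hnn_baseM !mulg1. Qed.
HB.instance Definition _ := Multiplicative_isUMagmaMorphism.Build U hnn hnn_base hnn_base1.

Lemma hnn_relE t w : (O : set U) w -> hnn_gen t * hnn_base w * (hnn_gen t)^-1 = hnn_base (phi w).
Proof.
move=> Ow; apply/divg1_eq.
have : hnn_relators (free_inr U (free_gen t) * free_inl _ w * (free_inr U (free_gen t))^-1
         * (free_inl _ (phi w))^-1) by exists t, w.
by move=> /qproj_rel; rewrite !gmulfM !gmulfV.
Qed.

Lemma hnn_ind (P : hnn -> Prop) : P 1 ->
  (forall u h, P h -> P (hnn_base u * h)) ->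
  (forall t h, P h -> P (hnn_gen t * h)) ->
  (forall t h, P h -> P ((hnn_gen t)^-1 * h)) -> forall h, P h.
Proof.
move=> P1 Pb Pg PV; apply: qproj_ind.
apply: free_prod_ind => [|u w Pw|f].
- exact: P1.
- by rewrite qprojM; exact: Pb.
- elim/free_group_ind: f => [|s f ih|s f ih] w Pw.
  + suff -> : free_inr U (1 : free_group S) = 1 by rewrite mul1g.
    by apply: (@mulgI _ (free_inr U 1)); rewrite -free_inrM !mulg1.
  + by rewrite free_inrM -mulgA qprojM; apply: Pg; exact: ih.
  + have -> : free_inr U ((free_gen s)^-1 * f) =
              (free_inr U (free_gen s))^-1 * free_inr U f.
      by apply: (@mulgI _ (free_inr U (free_gen s))); rewrite -free_inrM !mulVKg.
    by rewrite -mulgA qprojM gmulfV; apply: PV; exact: ih.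
Qed.

(* Exactly one topology has these properties: [hnn_topology_ex], [hnn_topology_uniq]. *)
Definition is_hnn_topology (tau : set (set hnn)) : Prop :=
  [/\ is_group_topology tau,
      (forall W, tau W -> open (hnn_base @^-1` W))
    & (forall V, open V -> tau (hnn_base @` V))].

Let hop : set (set hnn) :=
  [set W | forall h, open [set u | W (h * hnn_base u)]].

Let hopP W : hop W <-> (forall h, W h ->
  exists V : set U, [/\ open V, V 1 & forall v, V v -> W (h * hnn_base v)]).
Proof.
split=> [oW h Wh|hW h].
  exists [set u | W (h * hnn_base u)]; split=> //.
  by rewrite /= hnn_base1 mulg1.
rewrite openE => u /= Wu; have [V [oV V1 VW]] := hW _ Wu.
rewrite /interior; apply: (@filterS _ _ _ ( *%g u @` V)).
  by move=> _ [v Vv <-] /=; rewrite hnn_baseM mulgA; exact: VW.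
apply: open_nbhs_nbhs; split; first exact: open_lmulg.
by exists 1; rewrite ?mulg1.
Qed.

Let conj_small h (V : set U) : open V -> V 1 -> exists V' : set U,
  [/\ open V', V' 1 & forall v, V' v -> exists2 w, V w & hnn_base v * h = h * hnn_base w].
Proof.
elim/hnn_ind: h V => [|u h ih|t h ih|t h ih] V oV V1.
- by exists V; split=> // v Vv; exists v; rewrite // mulg1 mul1g.
- have [V' [oV' V'1 hV']] := ih V oV V1.
  exists ((fun v => v * u) @^-1` ( *%g u @` V')); split.
  + apply: open_comp; last exact: open_lmulg.
    by move=> x _; exact: rmulg_continuous.
  + by exists 1; rewrite // mul1g mulg1.
  + move=> v [v' V'v' /= e]; have [w Vw hw] := hV' _ V'v'; exists w => //.
    by rewrite mulgA -hnn_baseM -e hnn_baseM -!mulgA hw.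
- have [V' [oV' V'1 hV']] := ih V oV V1.
  exists (phi @` (V' `&` O)); split.
  + by apply: omono_open => //; apply: openI => //; exact: osubg_open.
  + exists 1; first by split=> //; exact: osubg1.
    have := omonoM phi (osubg1 O) (osubg1 O); rewrite mulg1 => e.
    by apply: (@mulgI _ (phi 1)); rewrite -e mulg1.
  + move=> _ [v [V'v Ov] <-]; have [w Vw hw] := hV' _ V'v; exists w => //.
    by rewrite -(hnn_relE t Ov) mulgA mulgVK -!mulgA hw.
- have [V' [oV' V'1 hV']] := ih V oV V1.
  exists (O `&` phi @^-1` V'); split.
  + have := @omono_continuous _ _ phi.
    rewrite continuous_open_subspace; last exact: osubg_open.
    move=> phic; rewrite openE => x [Ox V'x]; apply: filterI.
      by apply: open_nbhs_nbhs; split=> //; exact: osubg_open.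
    by apply: phic; [exact: mem_set|exact: open_nbhs_nbhs].
  + split; first exact: osubg1.
    have := omonoM phi (osubg1 O) (osubg1 O); rewrite mulg1 => e.
    suff e1 : phi 1 = 1 by rewrite /= e1.
    by apply: (@mulgI _ (phi 1)); rewrite -e mulg1.
  + move=> v [Ov V'v]; have [w Vw hw] := hV' _ V'v; exists w => //.
    apply: (@mulgI _ (hnn_gen t)); rewrite !mulgA mulgV mul1g -mulgA.
    by rewrite -hw -(hnn_relE t Ov) !mulgA.
Qed.

Let mulg_small (V : set U) : open V -> V 1 -> exists V' : set U,
  [/\ open V', V' 1 & forall v w, V' v -> V' w -> V (v * w)].
Proof.
move=> oV V1.
have /(_ V) := @mulg_continuous U (1, 1); rewrite /= mulg1.
case; first by apply: open_nbhs_nbhs.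
move=> [A B] /= [nA nB] AB.
exists (interior A `&` interior B); split.
- by apply: openI; exact: open_interior.
- by split.
- move=> v w [/interior_subset Av _] [_ /interior_subset Bw].
  exact: (AB (v, w)).
Qed.

Let hop_translate h V : open V -> hop [set h * hnn_base v | v in V].
Proof.
move=> oV; apply/hopP => _ [v Vv <-]; exists ( *%g v^-1 @` V); split.
- exact: open_lmulg.
- by exists v; rewrite // mulVg.
- by move=> _ [w Vw <-]; exists w; rewrite // -mulgA -hnn_baseM mulVKg.
Qed.

Let hop_hnn : is_hnn_topology hop.
Proof.
split.
- split.
  + by move=> h; exact: openT.
  + by move=> V W oV oW h; exact: openI (oV h) (oW h).
  + move=> I V oV h; have -> : [set u | (\bigcup_i V i) (h * hnn_base u)] =
      \bigcup_i [set u | V i (h * hnn_base u)] by [].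
    by apply: bigcup_open => i _; exact: oV.
  + move=> W x y /hopP oW /oW [V [oV V1 VW]].
    have [V1' [oV1 V11 V1V]] := mulg_small oV V1.
    have [V2 [oV2 V21 V2V]] := conj_small y oV1 V11.
    exists [set x * hnn_base v | v in V2], [set y * hnn_base v | v in V1'].
    split; try exact: hop_translate.
    * by exists 1; rewrite // hnn_base1 mulg1.
    * by exists 1; rewrite // hnn_base1 mulg1.
    * move=> _ _ [v Vv <-] [v' Vv' <-]; have [w Vw e] := V2V _ Vv.
      rewrite -mulgA (mulgA (hnn_base v)) e -mulgA -hnn_baseM mulgA.
      by apply: VW; exact: V1V.
  + move=> W /hopP oW; apply/hopP => h Wh; have [V [oV V1 VW]] := oW _ Wh.
    have [V2 [oV2 V21 V2V]] := conj_small h^-1 oV V1.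
    exists ((fun u : U => u^-1) @^-1` V2); split.
    * by apply: open_comp => // u _; exact: invg_continuous.
    * by rewrite /= invg1.
    * move=> v V2v; have [w Vw e] := V2V _ V2v.
      by rewrite /= invgM -gmulfV e; exact: VW.
- by move=> W oW; have := oW 1; under eq_set do rewrite mul1g.
- move=> V oV; have := hop_translate 1 oV; rewrite (_ : [set _ | _ in _] = hnn_base @` V)//.
  by apply: eq_imagel => v _; rewrite mul1g.
Qed.

Lemma hnn_topology_ex : exists tau, is_hnn_topology tau.
Proof. by exists hop. Qed.

Let hnn_topology_hop tau : is_hnn_topology tau -> tau = hop.
Proof.
move=> [[tT tI tU tM tV] tc to]; apply/seteqP.
have loc (V : set hnn) : (forall x, V x -> exists W, [/\ tau W, W x & W `<=` V]) -> tau V.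
  move=> h; pose I := {W : set hnn | tau W /\ W `<=` V}.
  have -> : V = \bigcup_(i : I) (projT1 i).
    apply/seteqP; split=> [x /h[W [tW Wx WV]]|x [[W [tW WV]] _ /= /WV//]].
    by exists (exist _ W (conj tW WV)).
  by apply: tU => -[W []].
have tmul (h : hnn) W : tau W -> tau ( *%g h @^-1` W).
  move=> tW; apply: loc => x Wx; have [A [B [tA tB Ah Bx AB]]] := tM _ _ _ tW Wx.
  by exists B; split=> // y By; exact: AB.
split=> [W tW h|W oW]; first exact: tc (tmul h W tW).
apply: loc => h Wh; exists ( *%g h^-1 @^-1` (hnn_base @` [set u | W (h * hnn_base u)])).
split.
- by apply: tmul; apply: to; exact: oW.
- by exists 1; rewrite /= ?hnn_base1 ?mulg1 ?mulVg.
- by move=> x [u /= Wu e]; have <- : h * hnn_base u = x by rewrite e mulVKg.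
Qed.

Lemma hnn_topology_uniq tau tau' :
  is_hnn_topology tau -> is_hnn_topology tau' -> tau = tau'.
Proof. by move=> /hnn_topology_hop -> /hnn_topology_hop ->. Qed.

Definition hnn_open : set (set hnn) := get is_hnn_topology.

Lemma hnn_openP : is_hnn_topology hnn_open.
Proof. by have [tau taup] := hnn_topology_ex; exact: (@getI _ is_hnn_topology tau). Qed.

Lemma hnn_openE : hnn_open = [set W | forall h, open [set u | W (h * hnn_base u)]].
Proof. exact: hnn_topology_hop hnn_openP. Qed.

Fact hnn_openT : hnn_open setT. Proof. by have [[]] := hnn_openP. Qed.
Fact hnn_openI : setI_closed hnn_open. Proof. by have [[]] := hnn_openP. Qed.
Fact hnn_open_bigU (I : Type) (f : I -> set hnn) :
  (forall i, hnn_open (f i)) -> hnn_open (\bigcup_i f i).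
Proof. by have [[_ _ tU _ _] _ _] := hnn_openP; exact: tU. Qed.

HB.instance Definition _ :=
  isOpenTopological.Build hnn hnn_openT hnn_openI hnn_open_bigU.

Fact hnn_mulg_continuous : continuous (fun z : hnn * hnn => z.1 * z.2).
Proof.
move=> [x y] W /=; rewrite nbhsE => -[B [oB Bxy] BW].
have [[_ _ _ tM _] _ _] := hnn_openP.
have [V [V' [oV oV' Vx Vy VV]]] := tM _ _ _ oB Bxy.
exists (V, V') => /=; first by split; exact: open_nbhs_nbhs.
by move=> [v v'] /= [Vv Vv']; apply: BW; exact: VV.
Qed.

Fact hnn_invg_continuous : continuous (fun x : hnn => x^-1).
Proof. by apply/continuousP => A; have [[_ _ _ _ tV] _ _] := hnn_openP; exact: tV. Qed.

HB.instance Definition _ := PreTopologicalGroup_isTopologicalGroup.Build hnn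
  hnn_mulg_continuous hnn_invg_continuous.

End HNN.

Section RAAG.
Variables (S : finType) (E : rel S) (U : topologicalGroupType) (O : openSubgroup U)
  (phi : openMono O).

Definition raag_relators : set (hnn S phi) :=
  [set r | exists s t, E s t /\
     r = hnn_gen phi s * hnn_gen phi t * (hnn_gen phi s)^-1 * (hnn_gen phi t)^-1].

Definition raag : Type := quotient_group raag_relators.
HB.instance Definition _ := Group.on raag.

Definition raag_proj (h : hnn S phi) : raag := qproj raag_relators h.
Definition raag_base (u : U) : raag := raag_proj (hnn_base S phi u).
Definition raag_gen (s : S) : raag := raag_proj (hnn_gen phi s).

HB.instance Definition _ := UMagmaMorphism.copy raag_proj (qproj raag_relators).

Lemma raag_proj_ind (P : raag -> Prop) : (forall h, P (raag_proj h)) -> forall g, P g.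
Proof. exact: qproj_ind. Qed.

Definition raag_open : set (set raag) := [set V | open (raag_proj @^-1` V)].

Fact raag_openT : raag_open setT. Proof. exact: openT. Qed.
Fact raag_openI : setI_closed raag_open. Proof. by move=> V W; exact: openI. Qed.
Fact raag_open_bigU (I : Type) (f : I -> set raag) :
  (forall i, raag_open (f i)) -> raag_open (\bigcup_i f i).
Proof. by move=> fo; apply: bigcup_open => i _; exact: fo. Qed.

HB.instance Definition _ :=
  isOpenTopological.Build raag raag_openT raag_openI raag_open_bigU.

Lemma raag_proj_continuous : continuous raag_proj.
Proof. exact/continuousP. Qed.

Lemma raag_proj_open (V : set (hnn S phi)) : open V -> open (raag_proj @` V).
Proof.
move=> oV; rewrite /open /= /raag_open /=.
have [N1 NM NV NJ] := normal_closure_normal raag_relators.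
have -> : raag_proj @^-1` (raag_proj @` V) =
  \bigcup_(n in normal_closure raag_relators) ((fun h => h * n) @^-1` V).
  apply/seteqP; split=> [h [v Vv /qprojP Nvh]|h [n Nn Vhn]].
    by exists (h^-1 * v); rewrite /= ?mulVKg//; have := NV _ Nvh; rewrite invgM invgK.
  by exists (h * n) => //; apply/esym/qprojP; rewrite mulKg.
by apply: bigcup_open => n _; apply: open_comp => // h _; exact: rmulg_continuous.
Qed.

Fact raag_mulg_continuous : continuous (fun z : raag * raag => z.1 * z.2).
Proof.
move=> [x y]; elim/raag_proj_ind: x => x; elim/raag_proj_ind: y => y W /=.
rewrite -gmulfM => /raag_proj_continuous/(@mulg_continuous (hnn S phi) (x, y)).
move=> [[A B] /= [nA nB] AB].
exists (raag_proj @` (interior A), raag_proj @` (interior B)) => /=.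
  split; apply: open_nbhs_nbhs; split; try exact/raag_proj_open/open_interior.
    by exists x.
  by exists y.
move=> [_ _] /= [[a /interior_subset Aa <-] [b /interior_subset Bb <-]].
by rewrite -gmulfM; exact: (AB (a, b)).
Qed.

Fact raag_invg_continuous : continuous (fun x : raag => x^-1).
Proof.
apply/continuousP => A oA; rewrite /open /= /raag_open /=.
have -> : raag_proj @^-1` ((fun x : raag => x^-1) @^-1` A) =
          (fun h => h^-1) @^-1` (raag_proj @^-1` A).
  by apply/seteqP; split=> h /=; rewrite gmulfV.
by apply: open_comp => // h _; exact: invg_continuous.
Qed.

HB.instance Definition _ := PreTopologicalGroup_isTopologicalGroup.Build raag
  raag_mulg_continuous raag_invg_continuous.

End RAAG.

Section Salvetti.
Variables (R : realType) (S : finType) (E : rel S) (U : topologicalGroupType)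
  (O : openSubgroup U) (phi : openMono O).
Local Notation A := (raag E phi).

(* The empty set and singletons are cliques. *)
Definition clique (T : {set S}) : bool :=
  [forall s in T, forall t in T, (s != t) ==> E s t].

Definition coset (g : A) : set A := [set g * raag_base E phi u | u in setT].

(* The product of the elements of [B], in the order of [enum S]; the factors commute
   when [B] is a clique. *)
Definition clique_elt (B : {set S}) : A := \prod_(t in B) raag_gen E phi t.

(* The vertex set of gQ_T; [B] is the set of those [t] with epsilon_t = 1. *)
Definition cell (g : A) (T : {set S}) : set (set A) :=
  [set coset (g * clique_elt B) | B in [set B : {set S} | B \subset T]].

(* [(g, T, x)] is the point of coordinates [x] in (a copy of) the cube gQ_T. Elements of
   [0,1]^T are extended by 0 to functions on [S]. *)
Definition is_cube_point (p : A * {set S} * {ffun S -> R}) : bool :=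
  clique p.1.2 &&
  [forall t, if t \in p.1.2 then (0 <= p.2 t <= 1)%R else p.2 t == 0%R].

Definition cube_point : Type := {p | is_cube_point p}.
HB.instance Definition _ := Choice.on cube_point.

Definition pt_base (p : cube_point) : A := (val p).1.1.
Definition pt_type (p : cube_point) : {set S} := (val p).1.2.
Definition pt_coord (p : cube_point) : {ffun S -> R} := (val p).2.

Inductive glue (p q : cube_point) : Prop :=
(* cubes of the same type with the same vertex set are identified *)
| glue_cell of cell (pt_base p) (pt_type p) = cell (pt_base q) (pt_type q) &
    pt_type p = pt_type q & pt_coord p = pt_coord q
(* the cube of [p] is the face of the cube of [q] on which the coordinates in [B] are 1
   and the other coordinates outside [pt_type p] are 0 *)
| glue_face (B : {set S}) of pt_type p \subset pt_type q &
    B \subset pt_type q :\: pt_type p &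
    pt_base p = pt_base q * clique_elt B &
    (forall t, pt_coord q t = if t \in B then 1%R else pt_coord p t).

Definition salvetti : Type := genquot glue.
HB.instance Definition _ := Choice.on salvetti.

Definition pt (p : cube_point) : salvetti := cls glue p.

Definition cube (g : A) (T : {set S}) : set salvetti :=
  [set pt p | p in [set p | pt_base p = g /\ pt_type p = T]].

Definition cubes (T : {set S}) : set (set salvetti) := [set cube g T | g in setT].

Fact vertex_subproof (g : A) : is_cube_point (g, finset.set0, [ffun=> 0%R]).
Proof.
apply/andP; split; first by apply/forallP => s; rewrite inE.
by apply/forallP => t; rewrite inE ffunE.
Qed.

(* The vertex gU is the only point of the cube of type [set0] based at [g]. *)
Definition vertex (g : A) : salvetti := pt (exist is_cube_point _ (vertex_subproof g)).

Definition euclid_dist (x y : {ffun S -> R}) : R :=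
  Num.sqrt (\sum_t (x t - y t) ^+ 2)%R.

(* [p] and [q] lie in a common cube, at distance [d] in that cube. *)
Definition segment (p q : salvetti) (d : R) : Prop :=
  exists x y : cube_point, [/\ pt_base x = pt_base y, pt_type x = pt_type y,
    pt x = p, pt y = q & d = euclid_dist (pt_coord x) (pt_coord y)].

Inductive string : salvetti -> salvetti -> R -> Prop :=
| string_nil p : string p p 0%R
| string_cons p q r d l of segment p q d & string q r l : string p r (d + l)%R.

(* The length metric: the infimum of the lengths of the broken lines from [p] to [q].
   It takes the value +oo on points that no such line joins. *)
Definition salvetti_dist (p q : salvetti) : \bar R :=
  ereal_inf [set l%:E | l in string p q].

Let sball (p : salvetti) (e : R) : set salvetti :=
  [set q | (salvetti_dist p q < e%:E)%E].

Let sballP p e q : sball p e q <-> exists2 l, string p q l & (l < e)%R.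
Proof.
split=> [/ereal_inf_lt[_ [l pql <-]]|[l pql le]].
  by rewrite lte_fin; exists l.
by apply: (@le_lt_trans _ _ l%:E); [apply: ereal_inf_lbound; exists l|rewrite lte_fin].
Qed.

Let string_cat p q r l l' : string p q l -> string q r l' -> string p r (l + l')%R.
Proof.
by elim=> [{}p|{}p p' {}q d {}l pp' _ ih /ih]; rewrite ?add0r// -addrA; exact: string_cons.
Qed.

Let segment_sym p q d : segment p q d -> segment q p d.
Proof.
move=> [x [y [gE TE xp yq ->]]]; exists y, x; split=> //.
by congr Num.sqrt; apply: eq_bigr => t _; rewrite -sqrrN opprB.
Qed.

Let string_sym p q l : string p q l -> string q p l.
Proof.
elim=> [{}p|{}p p' {}q d {}l /segment_sym pp' _ ih]; first exact: string_nil.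
rewrite addrC; apply: string_cat ih _; rewrite -[d]addr0.
exact: string_cons pp' (string_nil _).
Qed.

Fact salvetti_ball_center p (e : R) : (0 < e)%R -> sball p e p.
Proof. by move=> e0; apply/sballP; exists 0%R => //; exact: string_nil. Qed.

Fact salvetti_ball_sym p q (e : R) : sball p e q -> sball q e p.
Proof. by move=> /sballP[l /string_sym ? ?]; apply/sballP; exists l. Qed.

Fact salvetti_ball_triangle p q r (d e : R) :
  sball p d q -> sball q e r -> sball p (d + e)%R r.
Proof.
move=> /sballP[l pq ld] /sballP[l' qr le]; apply/sballP; exists (l + l')%R.
  exact: string_cat qr.
exact: ltrD.
Qed.

HB.instance Definition _ := hasNbhs.Build salvetti (nbhs_ (entourage_ sball)).
HB.instance Definition _ := Nbhs_isPseudoMetric.Build R salvetti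
  erefl salvetti_ball_center salvetti_ball_sym salvetti_ball_triangle erefl.

Lemma salvetti_ballE p (e : R) : ball p e = [set q | (salvetti_dist p q < e%:E)%E].
Proof. by []. Qed.

End Salvetti.
Arguments cube R {S E U O phi} g T.
Arguments cubes R {S} E {U O} phi T.
Arguments vertex R {S E U O phi} g.

Section Action.
Variables (G : groupType) (X : Type).

Definition is_action (act : G -> X -> X) : Prop :=
  (forall x, act 1 x = x) /\ (forall g h x, act (g * h) x = act g (act h x)).

Definition transitive_on (act : G -> X -> X) (C : set (set X)) : Prop :=
  (forall g c, C c -> C (act g @` c)) /\
  (forall c c', C c -> C c' -> exists g, act g @` c = c').

Definition stab (act : G -> X -> X) (Y : set X) : set G :=
  [set g | forall y, Y y -> act g y = y].

End Action.

Definition cocompact (G : groupType) (X : topologicalType) (act : G -> X -> X) : Prop :=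
  exists K : set X, compact K /\ \bigcup_g (act g @` K) = setT.

Definition conj_set (G : groupType) (g : G) (K : set G) : set G :=
  [set g * k * g^-1 | k in K].

(* Main.v *)
From HB Require Import structures.
From Stdlib Require Import Relation_Operators.
Require Import Defs.
From mathcomp Require Import all_boot all_order all_algebra.
From mathcomp Require Import all_classical all_reals all_analysis.
From mathcomp Require Import zify lra.
Set Implicit Arguments.
Unset Strict Implicit.
Unset Printing Implicit Defensive.
Import Order.TTheory GRing.Theory Num.Theory.
Import numFieldNormedType.Exports.
Local Open Scope classical_set_scope.
Local Open Scope group_scope.

(* The group acts by h (g, T, x) = (h g, T, x) on the points of the disjoint union of the
   cubes. This respects the gluing and maps segments to segments of the same length.

   A cube can only be fixed pointwise by an element that fixes its vertices. Rounding the
   coordinates of a point down gives a vertex gU that depends only on the glued point, so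
   that distinct cosets are distinct vertices and h fixes the vertex gU iff h is in
   g U g^-1. For the cube Q_T, walk along its vertices t_1 ... t_j U: if h = u in U fixes
   all of them, then u t_1 = t_1 v_1, v_1 t_2 = t_2 v_2, ... with all v_j in U.

   It remains to see that u t = t v in the RAAG forces v in O and u = phi(v), and that U
   embeds. Sending all generators to a single one maps the RAAG to an HNN extension, and
   instead of Britton's lemma one realises the latter by permutations of
   U x (O\U)^N x (phi(O)\U)^N: the group U translates the first factor, and the stable
   letter is the baker's map, which moves the O-coset of the first coordinate to the front
   of the second sequence and replaces it by the phi(O)-coset popped from the third. *)

(** * Universal properties: homomorphisms out of the presented groups *)

Lemma morph1 (G H : groupType) (f : G -> H) : {morph f : x y / x * y} -> f 1 = 1.
Proof. by move=> fM; apply: (@mulgI _ (f 1)); rewrite -fM !mulg1. Qed.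

Lemma morphV (G H : groupType) (f : G -> H) :
  {morph f : x y / x * y} -> {morph f : x / x^-1}.
Proof.
by move=> fM x; apply/esym/mulg1_eq; rewrite -fM mulgV; exact: morph1.
Qed.

(** The product of the values of [f] along a word is unchanged by every elementary step, hence
    constant on classes; [F] evaluates it on a chosen representative. *)
Lemma word_group_lift (X : choiceType) (inv : X -> X) rel (K : groupType) (f : X -> K) :
  (forall x, f (inv x) = (f x)^-1) ->
  (forall a b, rel a b -> \prod_(x <- a) f x = \prod_(x <- b) f x) ->
  exists2 F : word_group inv rel -> K,
    {morph F : x y / x * y} & forall x, F (letter inv rel x) = f x.
Proof.
move=> fV frel; pose p (w : seq X) := \prod_(x <- w) f x.
have pE a b : clos_refl_sym_trans _ (word_step inv rel) a b -> p a = p b.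
  elim=> // [_ _ [u v {}a {}b ab]|x y z _ xy _ yz]; last by rewrite xy.
  rewrite /p !big_cat; congr (_ * (_ * _)); case: ab => [{}a {}b /frel//|x|x].
    by rewrite big_cons big_seq1 big_nil fV /= mulgV.
  by rewrite big_cons big_seq1 big_nil fV /= mulVg.
pose F (c : word_group inv rel) := p (cls_repr c).
have FE w : F (word inv rel w) = p w by apply/pE/clsP; rewrite cls_reprK.
exists F => [x y|x]; last by rewrite FE /p big_seq1.
by rewrite -(cls_reprK x) -(cls_reprK y) word_mulE !FE /p big_cat.
Qed.

Lemma free_group_lift (S : choiceType) (K : groupType) (b : S -> K) :
  exists2 F : free_group S -> K,
    {morph F : x y / x * y} & forall s, F (free_gen s) = b s.
Proof.
pose f (x : S * bool) := if x.2 then b x.1 else (b x.1)^-1.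
have [||F FM Ff] := @word_group_lift (S * bool)%type
  (fun x => (x.1, ~~ x.2)) (fun _ _ => False) K f.
- by case=> s [] //=; rewrite /f/= invgK.
- by [].
- by exists F => // s; rewrite Ff.
Qed.

Lemma free_prod_lift (G H K : groupType) (a : G -> K) (b : H -> K) :
  {morph a : x y / x * y} -> {morph b : x y / x * y} ->
  exists F : free_prod G H -> K,
    [/\ {morph F : x y / x * y}, forall g, F (free_inl H g) = a g
      & forall h, F (free_inr G h) = b h].
Proof.
move=> aM bM; pose f (x : G + H) := match x with inl g => a g | inr h => b h end.
have [||F FM Ff] := @word_group_lift (G + H)%type
  (fun x => match x with inl g => inl g^-1 | inr h => inr h^-1 end)
  (@free_prod_rel G H) K f.
- by case=> ? /=; exact: morphV.
- move=> _ _ [||x y|x y]; rewrite ?big_cons ?big_nil ?mulg1 /=.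
  + exact: morph1.
  + exact: morph1.
  + by rewrite aM.
  + by rewrite bM.
- by exists F; split=> // ?; rewrite Ff.
Qed.

Lemma quotient_group_lift (G K : groupType) (X : set G) (f : G -> K) :
  {morph f : x y / x * y} -> (forall x, X x -> f x = 1) ->
  exists2 F : quotient_group X -> K,
    {morph F : x y / x * y} & forall x, F (qproj X x) = f x.
Proof.
move=> fM fX; have f1 := morph1 fM; have fV := morphV fM.
(* The kernel of [f] is one of the normal subgroups whose intersection is [normal_closure X]. *)
have fN x : normal_closure X x -> f x = 1.
  move/(_ (fun x => f x = 1)); apply; split=> //; split=> //.
  - by move=> y z fy fz; rewrite fM fy fz mulg1.
  - by move=> y fy; rewrite fV fy invg1.
  - by move=> y z fy; rewrite /conjg !fM fV fy mul1g mulVg.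
pose F (c : quotient_group X) := f (cls_repr c).
have FE x : F (qproj X x) = f x.
  have /qprojP/fN : qproj X (cls_repr (qproj X x)) = qproj X x by exact: cls_reprK.
  by rewrite fM fV => /mulg1_eq; rewrite invgK.
exists F => // x y; elim/qproj_ind: x => x; elim/qproj_ind: y => y.
by rewrite -qprojM !FE.
Qed.

(** The lift follows the construction: free group, free product, HNN extension, quotient by
    commutators. The hypotheses are the relators rewritten without inverses. *)
Lemma raag_lift (S : finType) (E : rel S) (U : topologicalGroupType)
    (O : openSubgroup U) (phi : openMono O) (K : groupType) (a : U -> K) (b : S -> K) :
  {morph a : u v / u * v} ->
  (forall t w, (O : set U) w -> b t * a w = a (phi w) * b t) ->
  (forall s t, E s t -> b s * b t = b t * b s) ->
  exists F : raag E phi -> K,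
    [/\ {morph F : x y / x * y}, forall u, F (raag_base E phi u) = a u
      & forall t, F (raag_gen E phi t) = b t].
Proof.
move=> aM abO bE; have [f fM fb] := free_group_lift b.
have [f2 [f2M f2a f2b]] := free_prod_lift aM fM.
have f2V := morphV f2M.
have [|f3 f3M f3E] := @quotient_group_lift _ K (hnn_relators phi) f2 f2M.
  move=> _ [t [w [Ow ->]]].
  by rewrite !f2M !f2V f2b !f2a fb abO// mulgK mulgV.
have f3V := morphV f3M.
have f3g s : f3 (hnn_gen phi s) = b s by rewrite f3E f2b fb.
have [|f4 f4M f4E] := @quotient_group_lift _ K (@raag_relators S E U O phi) f3 f3M.
  move=> _ [s [t [Est ->]]].
  by rewrite !f3M !f3V !f3g bE// mulgK mulgV.
exists f4; split=> // [u|t]; last by rewrite f4E f3g.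
by rewrite f4E f3E f2a.
Qed.

(** * The group of permutations of a type *)

Record permutation (X : Type) := Permutation {
  perm_fun :> X -> X;
  perm_inv : X -> X;
  perm_funK : cancel perm_fun perm_inv;
  perm_invK : cancel perm_inv perm_fun
}.

(** A function has at most one two-sided inverse, and the cancellation proofs agree by proof
    irrelevance. *)
Lemma permutation_eq (X : Type) (f g : permutation X) : f =1 g -> f = g.
Proof.
case: f g => [f f' fK f'K] [g g' gK g'K] /= /funext fg; subst g.
have ? : f' = g' by apply/funext => x; rewrite -[in LHS](g'K x) fK.
by subst g'; congr Permutation; exact: Prop_irrelevance.
Qed.

HB.instance Definition _ (X : Type) := gen_eqMixin (permutation X).
HB.instance Definition _ (X : Type) := gen_choiceMixin (permutation X).

Section PermutationGroup.
Variable X : Type.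
Implicit Types f g : permutation X.

Let pmul f g := Permutation (can_comp (perm_funK f) (perm_funK g))
  (can_comp (perm_invK g) (perm_invK f)).
Let pone := Permutation (frefl (@id X)) (frefl (@id X)).
Let pinv f := Permutation (perm_invK f) (perm_funK f).

Let pmulA : associative pmul. Proof. by move=> f g h; exact: permutation_eq. Qed.
Let pmul1 : left_id pone pmul. Proof. by move=> f; exact: permutation_eq. Qed.
Let pmulr1 : right_id pone pmul. Proof. by move=> f; exact: permutation_eq. Qed.
Let pmulV : left_inverse pone pinv pmul.
Proof. by move=> f; apply: permutation_eq => x; exact: perm_funK. Qed.
Let pmulVr : right_inverse pone pinv pmul.
Proof. by move=> f; apply: permutation_eq => x; exact: perm_invK. Qed.

HB.instance Definition _ :=
  isGroup.Build (permutation X) pmulA pmul1 pmulr1 pmulV pmulVr.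

Lemma permutationM f g x : (f * g) x = f (g x).
Proof. by []. Qed.

End PermutationGroup.

(** * Right cosets and their representatives *)

Section RightCosets.
Variables (U : groupType) (K : set U).
Hypotheses (K1 : K 1) (KM : forall x y, K x -> K y -> K (x * y)).
Hypothesis KV : forall x, K x -> K x^-1.

(** These are the right cosets [K x], which left translation by elements of [K] preserves. *)
Definition coset_space : Type := genquot (fun x y => K (y * x^-1)).

Definition rcoset_of (x : U) : coset_space := cls _ x.
Definition rcoset_repr (c : coset_space) : U := cls_repr c.

Lemma rcoset_ofP x y : rcoset_of x = rcoset_of y <-> K (y * x^-1).
Proof.
split=> [/clsP|Kyx]; last exact/clsP/rst_step.
elim=> {x y} [//|x|x y _|x y z _ xy _ yz].
- by rewrite mulgV.
- by move/KV; rewrite invgM invgK.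
- by have := KM yz xy; rewrite mulgA mulgVK.
Qed.

Lemma rcoset_of_mulKrepr k c : K k -> rcoset_of (k * rcoset_repr c) = c.
Proof.
rewrite -[RHS](cls_reprK c) => Kk; apply/rcoset_ofP.
by rewrite invgM mulgA mulgV mul1g; exact: KV.
Qed.

Lemma rcoset_of_mulK k x : K k -> rcoset_of (k * x) = rcoset_of x.
Proof. by move=> Kk; apply/rcoset_ofP; rewrite invgM mulgA mulgV mul1g; exact: KV. Qed.

Lemma rcoset_reprP x : K (x * (rcoset_repr (rcoset_of x))^-1).
Proof. by apply/rcoset_ofP; exact: cls_reprK. Qed.

End RightCosets.

Definition scons (T : Type) (c : T) (p : nat -> T) (n : nat) : T :=
  if n is n'.+1 then p n' else c.
Definition stail (T : Type) (p : nat -> T) (n : nat) : T := p n.+1.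

Lemma scons_eta (T : Type) (p : nat -> T) : scons (p 0%N) (stail p) = p.
Proof. by apply/funext => -[]. Qed.

(** * The baker's map and its commutation with translations *)

Section BakerMap.
Variables (U : topologicalGroupType) (O : openSubgroup U) (phi : openMono O).
Local Notation P := (phi @` (O : set U)).

Lemma omono1 : phi 1 = 1.
Proof.
have := omonoM phi (osubg1 O) (osubg1 O); rewrite mulg1 => e.
by apply: (@mulgI _ (phi 1)); rewrite -e mulg1.
Qed.

Lemma omono_imageV y : P y -> P y^-1.
Proof.
move=> [x Ox <-]; exists x^-1; first exact: osubgV.
apply/esym/mulg1_eq; rewrite -omonoM ?mulgV//; first exact: omono1.
exact: osubgV.
Qed.

Lemma omono_imageM x y : P x -> P y -> P (x * y).
Proof.
move=> [x' Ox <-] [y' Oy <-]; exists (x' * y'); first exact: osubgM.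
exact: omonoM.
Qed.

Lemma omono_image1 : P 1.
Proof. by exists 1; [exact: osubg1|exact: omono1]. Qed.

Local Notation Q1 := (coset_space (O : set U)).
Local Notation Q2 := (coset_space P).
(** As a set, [U] is [O] times [Q1] and also [P] times [Q2]. The infinite sequences absorb the
    factors [Q1] and [Q2], so that the bijection [phi] from [O] to [P] extends to a bijection of the
    whole space. *)
Definition baker_space : Type := U * ((nat -> Q1) * (nat -> Q2)).
Implicit Types x : baker_space.

Let c1 : U -> Q1 := @rcoset_of _ O.
Let c2 : U -> Q2 := @rcoset_of _ P.
Let r1 : Q1 -> U := @rcoset_repr _ O.
Let r2 : Q2 -> U := @rcoset_repr _ P.
(** The inverse of [phi] on its image, with default value 1 elsewhere. *)
Let psi (y : U) : U := xget 1 [set x | (O : set U) x /\ phi x = y].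

Let psiK w : (O : set U) w -> psi (phi w) = w.
Proof.
move=> Ow; rewrite /psi; case: xgetP => [x _ [Ox]|/(_ w)[]//].
exact: omono_inj.
Qed.

(** The factor [x.1 * (r1 (c1 x.1))^-1] is the component of [x.1] in [O]. Its image in [P] is
    completed to an element of [U] by the representative of the popped coset. *)
Definition baker_fun x : baker_space :=
  (phi (x.1 * (r1 (c1 x.1))^-1) * r2 (x.2.2 0%N),
   (scons (c1 x.1) x.2.1, stail x.2.2)).

Definition baker_inv x : baker_space :=
  (psi (x.1 * (r2 (c2 x.1))^-1) * r1 (x.2.1 0%N),
   (stail x.2.1, scons (c2 x.1) x.2.2)).

Let c1E w c : (O : set U) w -> c1 (w * r1 c) = c.
Proof. by apply: rcoset_of_mulKrepr; [exact: osubg1|exact: osubgM|exact: osubgV]. Qed.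

Let c2E w c : P w -> c2 (w * r2 c) = c.
Proof.
by apply: rcoset_of_mulKrepr;
  [exact: omono_image1|exact: omono_imageM|exact: omono_imageV].
Qed.

Let c1P w : (O : set U) (w * (r1 (c1 w))^-1).
Proof. by apply: rcoset_reprP; [exact: osubg1|exact: osubgM|exact: osubgV]. Qed.

Let c2P w : P (w * (r2 (c2 w))^-1).
Proof.
by apply: rcoset_reprP;
  [exact: omono_image1|exact: omono_imageM|exact: omono_imageV].
Qed.

Lemma baker_funK : cancel baker_fun baker_inv.
Proof.
move=> [w [p q]]; rewrite /baker_fun /baker_inv /= c2E; last by exists (w * (r1 (c1 w))^-1).
by rewrite mulgK psiK// mulgVK scons_eta.
Qed.

Lemma baker_invK : cancel baker_inv baker_fun.
Proof.
move=> [w [p q]]; rewrite /baker_fun /baker_inv /=.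
have [v Ov e] := c2P w; rewrite -e psiK// c1E// mulgK e mulgVK.
by rewrite scons_eta.
Qed.

Definition baker : permutation baker_space := Permutation baker_funK baker_invK.

Definition left_translation (u : U) : permutation baker_space :=
  @Permutation _ (fun x => (u * x.1, x.2)) (fun x => (u^-1 * x.1, x.2))
    (fun x => ltac:(by case: x => w p /=; rewrite mulKg))
    (fun x => ltac:(by case: x => w p /=; rewrite mulVKg)).

Lemma left_translationM : {morph left_translation : u v / u * v}.
Proof. by move=> u v; apply: permutation_eq => -[w p]; rewrite permutationM /= mulgA. Qed.

Lemma left_translation_inj : injective left_translation.
Proof.
move=> u v uv.
have := congr1 (fun f : permutation baker_space => (f (1, (fun=> c1 1, fun=> c2 1))).1) uv.
by rewrite /= !mulg1.
Qed.

Lemma baker_translation w : (O : set U) w ->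
  baker * left_translation w = left_translation (phi w) * baker.
Proof.
move=> Ow; apply: permutation_eq => -[v [p q]]; rewrite !permutationM /= /baker_fun /=.
rewrite /c1 rcoset_of_mulK//; [|exact: osubg1|exact: osubgM|exact: osubgV].
by rewrite -(mulgA w) [phi (w * _)]omonoM ?mulgA//; exact: c1P.
Qed.

(** At a point with first coordinate 1, the left-hand side pushes the coset of 1 and the right-hand
    side that of [v]; hence [v] lies in [O]. Then [baker_translation] applies to [v], and cancelling
    [baker] identifies [u]. *)
Lemma baker_pinch u v :
  left_translation u * baker = baker * left_translation v -> (O : set U) v /\ u = phi v.
Proof.
move=> uv.
have Ov : (O : set U) v.
  have := congr1 (fun f : permutation baker_space =>
    (f (1, (fun=> c1 1, fun=> c2 1))).2.1 0%N) uv.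
  rewrite !permutationM /= mulg1 => /rcoset_ofP; rewrite invg1 mulg1.
  by apply; [exact: osubg1|exact: osubgM|exact: osubgV].
split=> //; apply: left_translation_inj; apply: (@mulIg _ baker).
by rewrite uv baker_translation.
Qed.

End BakerMap.

(** * The base group in the RAAG: embedding, pinches and exponent sums *)

Section RaagBase.
Variables (S : finType) (E : rel S) (U : topologicalGroupType)
  (O : openSubgroup U) (phi : openMono O).
Local Notation base := (raag_base E phi).
Local Notation gen := (raag_gen E phi).

Lemma raag_projM : {morph @raag_proj S E U O phi : x y / x * y}.
Proof. exact: qprojM. Qed.

Lemma raag_baseM : {morph base : u v / u * v}.
Proof. by move=> u v; rewrite /raag_base hnn_baseM raag_projM. Qed.

Lemma raag_base1 : base 1 = 1.
Proof. exact: morph1 raag_baseM. Qed.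

Lemma raag_gen_base t w : (O : set U) w -> gen t * base w = base (phi w) * gen t.
Proof.
move=> Ow; rewrite /raag_base -(hnn_relE phi t Ow).
by rewrite /raag_gen -!raag_projM mulgVK.
Qed.

Lemma raag_gen_commute s t : E s t -> commute (gen s) (gen t).
Proof.
move=> Est; apply: divg1_eq.
have : raag_relators E (hnn_gen phi s * hnn_gen phi t * (hnn_gen phi s)^-1 *
   (hnn_gen phi t)^-1) by exists s, t.
by move=> /qproj_rel; rewrite !gmulfM !gmulfV invgM !mulgA.
Qed.

Lemma raag_baker : exists F : raag E phi -> permutation (baker_space phi),
  [/\ {morph F : x y / x * y}, forall u, F (base u) = left_translation phi u
    & forall t, F (gen t) = baker phi].
Proof.
apply: raag_lift => //; first exact: left_translationM.
by move=> _ w; exact: baker_translation.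
Qed.

Lemma raag_base_inj : injective base.
Proof.
have [F [FM Fb Fg]] := raag_baker.
by move=> u v /(congr1 F); rewrite !Fb; exact: left_translation_inj.
Qed.

Lemma raag_pinch u v t : base u * gen t = gen t * base v -> (O : set U) v /\ u = phi v.
Proof.
have [F [FM Fb Fg]] := raag_baker.
by move/(congr1 F); rewrite !FM !Fb Fg; exact: baker_pinch.
Qed.

(** The exponent sum of [s] vanishes on every relator. It is encoded by translations of the integers
    because the target of [raag_lift] is a multiplicative group. *)
Lemma raag_height s : exists F : raag E phi -> permutation int,
  [/\ {morph F : x y / x * y}, forall u, F (base u) = 1
    & forall t m, F (gen t) m = (m + (t == s)%:Z)%R].
Proof.
pose b (t : S) := @Permutation int (fun m => m + (t == s)%:Z)%R
  (fun m => m - (t == s)%:Z)%R (addrK _) (subrK _).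
have [|//||F [FM Fb Fg]] := @raag_lift S E U O phi (permutation int) (fun=> 1) b.
- by move=> u v; rewrite mulg1.
- by move=> t w _; rewrite mulg1 mul1g.
- by move=> t t' _; apply: permutation_eq => m; rewrite !permutationM /= addrAC.
by exists F; split=> // t m; rewrite Fg.
Qed.

End RaagBase.

(** * Products over cliques, cosets and vertex sets of cubes *)

Section Cells.
Variables (S : finType) (E : rel S) (U : topologicalGroupType)
  (O : openSubgroup U) (phi : openMono O).
Local Notation A := (raag E phi).
Local Notation base := (raag_base E phi).
Local Notation gen := (raag_gen E phi).
Local Notation elt := (clique_elt E phi).
Implicit Types (g h : A) (T B : {set S}).

Lemma raag_ind (P : A -> Prop) : P 1 ->
  (forall u g, P g -> P (base u * g)) ->
  (forall t g, P g -> P (gen t * g)) ->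
  (forall t g, P g -> P ((gen t)^-1 * g)) -> forall g, P g.
Proof.
move=> P1 Pb Pg PV; elim/raag_proj_ind; elim/hnn_ind => [|u h ih|t h ih|t h ih].
- by rewrite (morph1 (@raag_projM S E U O phi)).
- by rewrite raag_projM; exact: Pb.
- by rewrite raag_projM; exact: Pg.
- by rewrite raag_projM (morphV (@raag_projM S E U O phi)); exact: PV.
Qed.

Lemma raag_exponent_sum (s : S) : exists f : A -> int,
  [/\ forall x y, f (x * y) = (f x + f y)%R, forall u, f (base u) = 0%R
    & forall t, f (gen t) = Posz (t == s)].
Proof.
have [F [FM Fb Fg]] := raag_height E phi s.
(* Every [F g] is a translation, so evaluation at 0 turns composition into addition. *)
have FE g m : F g m = (F g 0 + m)%R.
  elim/raag_ind: g m => [|u g ih|t g ih|t g ih] m.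
  - by rewrite (morph1 FM) [LHS]/= add0r.
  - by rewrite FM Fb mul1g.
  - by rewrite FM !permutationM !Fg ih addrAC.
  - have FV k : F (gen t)^-1 k = (k - (t == s)%:Z)%R.
      rewrite (morphV FM); apply: (can_inj (perm_funK (F (gen t)))).
      by rewrite [LHS](perm_invK (F (gen t)) k) Fg subrK.
    by rewrite FM !permutationM !FV ih addrAC.
exists (fun g => F g 0%R); split=> [x y|u|t].
- by rewrite FM permutationM FE.
- by rewrite Fb.
- by rewrite Fg add0r.
Qed.

Lemma clique_commute T s t : clique E T -> s \in T -> t \in T -> commute (gen s) (gen t).
Proof.
move=> /forall_inP/(_ s) + sT tT => /(_ sT)/forall_inP/(_ t tT)/implyP.
by case: (eqVneq s t) => [->//|_ /(_ isT)]; exact: raag_gen_commute.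
Qed.

(** Both products are extended to all of [S] by trivial factors and merged factor by factor; the
    generators that have to change places lie in the clique [T]. *)
Lemma clique_eltU T B B' : clique E T -> B \subset T -> B' \subset T ->
  [disjoint B & B']%B -> elt (B :|: B') = elt B * elt B'.
Proof.
move=> cT BT B'T dBB'; rewrite /clique_elt.
rewrite [X in _ = X * _]big_mkcond [X in _ = _ * X]big_mkcond -prodgM_commute.
  rewrite big_mkcond; apply: eq_bigr => t _; rewrite inE.
  case: (boolP (t \in B)) => [tB|_] /=; last by rewrite mul1g.
  by rewrite (disjointFr dBB' tB) mulg1.
move=> s t _ _; case: ifPn => [sB|_]; last exact/commute_sym/commute1.
case: ifPn => [tB'|_]; last exact: commute1.
by apply: (clique_commute cT); [exact: (fintype.subsetP BT)|exact: (fintype.subsetP B'T)].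
Qed.

Lemma clique_elt0 : elt finset.set0 = 1.
Proof. by rewrite /clique_elt big_set0. Qed.

Lemma clique_elt1 t : elt [set t]%SET = gen t.
Proof. by rewrite /clique_elt big_set1. Qed.

(** This frees [clique_elt] from its fixed order, so that the prefixes of a list of elements of a
    clique describe a path of vertices in a cube. *)
Lemma clique_elt_seq T (s : seq S) : clique E T -> uniq s -> {subset s <= T} ->
  elt [set t in s]%SET = \prod_(t <- s) gen t.
Proof.
move=> cT; elim: s => [|t s ih] /=.
  by move=> _ _; rewrite big_nil -clique_elt0; congr elt; apply/setP => t; rewrite !inE.
move=> /andP[ts us] sT; rewrite big_cons /= -ih//; last first.
  by move=> x xs; apply: sT; rewrite inE xs orbT.
rewrite -clique_elt1 -(clique_eltU cT).
- by congr elt; apply/setP => x; rewrite !inE.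
- by rewrite finset.sub1set sT// mem_head.
- by apply/fintype.subsetP => x; rewrite inE => xs; apply: sT; rewrite inE xs orbT.
- by rewrite disjoints1 inE.
Qed.

Lemma exponent_sum_clique_elt (s : S) (f : A -> int) B :
  (forall x y, f (x * y) = (f x + f y)%R) -> (forall t, f (gen t) = Posz (t == s)) ->
  f (elt B) = Posz (s \in B).
Proof.
move=> fM fg; have f1 : f 1 = 0%R by apply: (addrI (f 1)); rewrite -fM mulg1 addr0.
rewrite /clique_elt (big_morph f fM f1) (eq_bigr _ (fun t _ => fg t)).
have [sB|sB] := boolP (s \in B).
  rewrite (bigD1 s)//= eqxx big1 ?addr0// => t /andP[_ ts].
  by rewrite (negbTE ts).
by rewrite big1// => t tB; case: eqVneq tB sB => // -> ->.
Qed.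

Lemma cosetP g h : coset g = coset h <-> exists u, g = h * base u.
Proof.
split=> [gh|[u ->]].
  have : coset g g by exists 1; rewrite ?raag_base1 ?mulg1.
  by rewrite gh => -[u _ <-]; exists u.
apply/seteqP; split=> _ [v _ <-].
  by exists (u * v); rewrite // raag_baseM mulgA.
by exists (u^-1 * v); rewrite // -mulgA -raag_baseM mulVKg.
Qed.

Lemma coset_mul h g : coset (h * g) = *%g h @` coset g.
Proof.
apply/seteqP; split=> [_ [u _ <-]|_ [_ [u _ <-] <-]].
  by exists (g * base u); [exists u|rewrite mulgA].
by exists u; rewrite // mulgA.
Qed.

Lemma cell_mul h g T : cell (h * g) T = [set *%g h @` c | c in cell g T].
Proof.
apply/seteqP; split=> [_ [B BT <-]|_ [_ [B BT <-] <-]].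
  by exists (coset (g * elt B)); [exists B|rewrite -mulgA -coset_mul].
by exists B => //; rewrite -mulgA; exact: coset_mul.
Qed.

(* Exponent sums distinguish the vertices of a cube, so the vertex set of a cube
   determines the label of each of its vertices. *)
Lemma cell_eq_coset g h T : cell g T = cell h T ->
  forall B, B \subset T -> coset (g * elt B) = coset (h * elt B).
Proof.
move=> gh B BT.
have exps g1 h1 (B1 B2 : {set S}) : coset (g1 * elt B1) = coset (h1 * elt B2) ->
    forall s (f : A -> int), (forall x y, f (x * y) = (f x + f y)%R) ->
    (forall u, f (base u) = 0%R) -> (forall t, f (gen t) = Posz (t == s)) ->
    (f g1 + Posz (s \in B1) = f h1 + Posz (s \in B2))%R.
  move=> /cosetP[u e] s f fM fb fg; move/(congr1 f): e.
  by rewrite !fM fb addr0 !(exponent_sum_clique_elt _ fM fg).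
have [C CT gC] : cell h T (coset (g * elt finset.set0)).
  by rewrite -gh; exists finset.set0 => //=; exact: finset.sub0set.
have [D DT hD] : cell g T (coset (h * elt finset.set0)).
  by rewrite gh; exists finset.set0 => //=; exact: finset.sub0set.
(* By [gC] the exponent sum of [g] is at least that of [h], and by [hD] the converse holds. *)
have fgh s (f : A -> int) : (forall x y, f (x * y) = (f x + f y)%R) ->
    (forall u, f (base u) = 0%R) -> (forall t, f (gen t) = Posz (t == s)) -> f g = f h.
  move=> fM fb fg; have := exps _ _ _ _ gC s f fM fb fg.
  have := exps _ _ _ _ hD s f fM fb fg.
  rewrite !inE; case: (s \in C); case: (s \in D) => /=; lia.
have [B' B'T gB] : cell h T (coset (g * elt B)) by rewrite -gh; exists B.
rewrite -gB; congr (coset (h * elt _)); apply/setP => s.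
have [f [fM fb fg]] := raag_exponent_sum s.
have := exps _ _ _ _ gB s f fM fb fg; rewrite (fgh s f fM fb fg) => /addrI[].
by case: (s \in B); case: (s \in B').
Qed.

Lemma eq_cell g h T :
  (forall B, B \subset T -> coset (g * elt B) = coset (h * elt B)) -> cell g T = cell h T.
Proof.
by move=> gh; apply/seteqP; split=> _ [B BT <-]; exists B => //; rewrite gh.
Qed.

End Cells.

(** * Points of the complex, the action and the general stabilisers *)

Section Points.
Variables (R : realType) (S : finType) (E : rel S) (U : topologicalGroupType)
  (O : openSubgroup U) (phi : openMono O).
Local Notation A := (raag E phi).
Local Notation base := (raag_base E phi).
Local Notation gen := (raag_gen E phi).
Local Notation elt := (clique_elt E phi).
Local Notation cpt := (cube_point R E phi).
Local Notation X := (salvetti R E phi).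
Implicit Types (g h : A) (T B : {set S}) (p q : cpt).

Lemma cube_point_eq p q : pt_base p = pt_base q -> pt_type p = pt_type q ->
  pt_coord p = pt_coord q -> p = q.
Proof.
move=> b t c; apply: val_inj; move: b t c; rewrite /pt_base /pt_type /pt_coord.
by case: (val p) (val q) => [[g T] x] [[h T'] y] /= -> -> ->.
Qed.

Lemma pt_type_clique p : clique E (pt_type p).
Proof. by have /andP[] := valP p. Qed.

Lemma pt_coordP p t :
  if t \in pt_type p then (0 <= pt_coord p t <= 1)%R else pt_coord p t == 0%R.
Proof. by have /andP[_ /forallP/(_ t)] := valP p. Qed.

(* The vertex of the cube of [p] obtained by rounding the coordinates of [p] down. *)
Definition corner p : set A :=
  coset (pt_base p * elt [set t | pt_coord p t == 1%R]%SET).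

Lemma corner_sub p : [set t | pt_coord p t == 1%R]%SET \subset pt_type p.
Proof.
apply/fintype.subsetP => t; rewrite inE => /eqP t1; have := pt_coordP p t.
by case: ifPn => //; rewrite t1 oner_eq0.
Qed.

(** Cubes with the same vertex set have the same labelled vertices by [cell_eq_coset]. For a face,
    the coordinates of [q] equal to 1 are those in [B] together with those of [p], and the two sets
    are disjoint. *)
Lemma glue_corner p q : Defs.glue p q -> corner p = corner q.
Proof.
case=> [pq tpq cpq|B pq BpT bp cq].
  by rewrite /corner cpq; apply: (cell_eq_coset (T := pt_type q));
    [rewrite -pq tpq|exact: corner_sub].
rewrite /corner bp -mulgA; congr (coset (_ * _)).
move: BpT; rewrite finset.subsetD => /andP[Bq Bp].
rewrite -(@clique_eltU _ _ _ _ _ (pt_type q)) //.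
- by congr elt; apply/setP => t; rewrite !inE cq; case: ifPn => //; rewrite eqxx.
- exact: pt_type_clique.
- exact: fintype.subset_trans (corner_sub p) pq.
- exact: fintype.disjointWr (corner_sub p) Bp.
Qed.

Lemma pt_corner p q : pt p = pt q -> corner p = corner q.
Proof.
move=> /clsP; elim=> {p q} [p q /glue_corner//|//|p q _ -> //|p q r _ -> _ ->//].
Qed.

Lemma corner_vertex g :
  corner (exist (@is_cube_point R S E U O phi) _ (vertex_subproof R g)) = coset g.
Proof.
rewrite /corner [pt_base _]/=; congr coset.
rewrite -[RHS]mulg1 -clique_elt0; congr (_ * elt _).
by apply/setP => t; rewrite !inE /pt_coord /= ffunE eq_sym oner_eq0.
Qed.

Lemma vertex_eqP g h : vertex R g = vertex R h :> X <-> coset g = coset h.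
Proof.
split=> [/pt_corner|gh]; first by rewrite !corner_vertex.
apply/clsP/rst_step/glue_cell => //; rewrite /pt_type /pt_base /=.
apply: eq_cell => B; rewrite finset.subset0 => /eqP ->.
by rewrite clique_elt0 !mulg1.
Qed.

Fact cube_pt_subproof g T (x : {ffun S -> R}) : clique E T ->
  is_cube_point (g, T, [ffun t => if t \in T then Num.max 0 (Num.min (x t) 1) else 0])%R.
Proof.
move=> cT; apply/andP; split=> //; apply/forallP => t /=.
have [tT|tT] := boolP (t \in T); rewrite ffunE ?tT ?(negbTE tT)//.
by rewrite le_max lexx /= ge_max ler01 /= ge_min lexx orbT.
Qed.

(** Clamping to the unit interval, and to 0 outside [T], makes the parametrisation of the cube
    total, so that it can be composed with maps from a vector space. *)
Definition cube_pt g T (cT : clique E T) (x : {ffun S -> R}) : X :=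
  pt (exist (@is_cube_point R S E U O phi) _ (cube_pt_subproof g x cT)).

(** A vertex is a face of type [set0], glued into the cube with the coordinates in [B] equal to 1
    and the others 0. *)
Lemma vertex_cube_pt g T (cT : clique E T) B : B \subset T ->
  vertex R (g * elt B) = cube_pt g cT [ffun t => (t \in B)%:R%R].
Proof.
move=> BT; apply/clsP/rst_step; apply: (@glue_face _ _ _ _ _ _ _ _ B).
- exact: finset.sub0set.
- by rewrite finset.setD0.
- by [].
- move=> t; rewrite /pt_coord /= !ffunE; case: ifPn => tT; last first.
    by case: ifPn => // tB; rewrite (fintype.subsetP BT _ tB) in tT.
  by case: (t \in B); rewrite /= ?minxx ?(min_l ler01) ?(max_r ler01) ?maxxx.
Qed.

Lemma cube_cube_pt g T (cT : clique E T) : cube R g T = range (cube_pt g cT).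
Proof.
apply/seteqP; split=> [_ [p [pg pT] <-]|_ [x _ <-]]; last first.
  by exists (exist (@is_cube_point R S E U O phi) _ (cube_pt_subproof g x cT)).
exists (pt_coord p) => //; congr pt; apply: cube_point_eq => //.
apply/ffunP => t; rewrite [LHS]ffunE -pT; have := pt_coordP p t.
by case: ifPn => _ => [/andP[p0 p1]|/eqP->//]; rewrite (min_l p1) (max_r p0).
Qed.

Lemma cube_vertex g T B : clique E T -> B \subset T -> cube R g T (vertex R (g * elt B)).
Proof.
move=> cT BT; rewrite (cube_cube_pt _ cT) (vertex_cube_pt _ cT BT).
by exists [ffun t => (t \in B)%:R%R].
Qed.

Fact act_pt_subproof h p : is_cube_point (h * pt_base p, pt_type p, pt_coord p).
Proof. exact: (valP p). Qed.

Definition act_pt h p : cpt := exist (@is_cube_point R S E U O phi) _ (act_pt_subproof h p).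

Lemma glue_act_pt h p q : Defs.glue p q -> Defs.glue (act_pt h p) (act_pt h q).
Proof.
case=> [pq tpq cpq|B pq BpT bp cq].
  by apply: glue_cell => //; rewrite [LHS]cell_mul [RHS]cell_mul pq.
apply: (@glue_face _ _ _ _ _ _ _ _ B) => //.
by rewrite [LHS](congr1 ( *%g h) bp) mulgA.
Qed.

Definition salvetti_act h (x : X) : X := pt (act_pt h (cls_repr x)).

Lemma salvetti_actE h p : salvetti_act h (pt p) = pt (act_pt h p).
Proof.
suff act_pt_eq q r : pt q = pt r -> pt (act_pt h q) = pt (act_pt h r).
  by apply: act_pt_eq; exact: cls_reprK.
move=> /clsP; elim=> {q r} [q r /(glue_act_pt h) qr|//|//|q r s _ -> _ ->//].
by apply/clsP/rst_step.
Qed.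

Lemma salvetti_ind (P : X -> Prop) : (forall p, P (pt p)) -> forall x, P x.
Proof. exact: cls_ind. Qed.

Lemma salvetti_act_action : is_action salvetti_act.
Proof.
split=> [|g h]; elim/salvetti_ind => p; rewrite !salvetti_actE; congr pt.
  by apply: cube_point_eq => //; exact: mul1g.
by apply: cube_point_eq => //; rewrite [LHS]/pt_base /= -mulgA.
Qed.

Lemma salvetti_act_vertex h g : salvetti_act h (vertex R g) = vertex R (h * g).
Proof. by rewrite salvetti_actE; congr pt; exact: cube_point_eq. Qed.

Lemma salvetti_act_cube h g T : salvetti_act h @` cube R g T = cube R (h * g) T.
Proof.
apply/seteqP; split=> [_ [_ [p [pg pT] <-] <-]|_ [p [pg pT] <-]].
  rewrite salvetti_actE; exists (act_pt h p) => //; split=> //.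
  by rewrite -pg.
exists (pt (act_pt h^-1 p)).
  exists (act_pt h^-1 p) => //; split=> //.
  by rewrite [LHS]/pt_base /= pg mulKg.
rewrite salvetti_actE; congr pt; apply: cube_point_eq => //.
by rewrite [LHS]/pt_base /= mulVKg.
Qed.

Lemma segment_act h x y d : segment x y d ->
  segment (salvetti_act h x) (salvetti_act h y) d.
Proof.
move=> [p [q [bpq tpq <- <- ->]]]; exists (act_pt h p), (act_pt h q).
split=> //; try by rewrite salvetti_actE.
by rewrite /pt_base /= -/(pt_base p) bpq.
Qed.

Lemma string_act h x y l : string x y l ->
  string (salvetti_act h x) (salvetti_act h y) l.
Proof.
elim=> [z|x' y' z d l' xy _ ih]; first exact: string_nil.
by apply: string_cons ih; exact: segment_act.
Qed.

Lemma salvetti_act_isometry h x y :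
  salvetti_dist (salvetti_act h x) (salvetti_act h y) = salvetti_dist x y.
Proof.
have [act1 actM] := salvetti_act_action.
congr ereal_inf; apply/seteqP; split=> _ [l xy <-]; exists l => //; last exact: string_act.
by have := string_act h^-1 xy; rewrite -!actM mulVg !act1.
Qed.

Lemma salvetti_act_transitive T : transitive_on salvetti_act (cubes R E phi T).
Proof.
split=> [h _ [g _ <-]|_ _ [g _ <-] [h _ <-]].
  by exists (h * g) => //; rewrite salvetti_act_cube.
by exists (h * g^-1); rewrite salvetti_act_cube mulgVK.
Qed.

Lemma stab_vertex g : stab salvetti_act [set vertex R g] = conj_set g (base @` setT).
Proof.
apply/seteqP; split=> [h /(_ _ erefl)|_ [_ [u _ <-] <-] _ ->].
  rewrite salvetti_act_vertex => /vertex_eqP/cosetP[u hg].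
  by exists (base u); [exists u|rewrite -hg mulgK].
by rewrite salvetti_act_vertex; apply/vertex_eqP/cosetP; exists u; rewrite mulgVK.
Qed.

Lemma stab_cube g T :
  stab salvetti_act (cube R g T) = conj_set g (stab salvetti_act (cube R 1 T)).
Proof.
have [act1 actM] := salvetti_act_action.
have sub h : stab salvetti_act (cube R 1 T) h ->
    stab salvetti_act (cube R g T) (g * h * g^-1).
  move=> sh y; rewrite -[g]mulg1 -salvetti_act_cube => -[x Tx <-].
  by rewrite -actM mulg1 mulgVK actM sh.
apply/seteqP; split=> [h sh|_ [h sh <-]]; last exact: sub.
exists (g^-1 * h * g); last by rewrite !mulgA mulgV mul1g mulgK.
move=> y Ty; rewrite !actM sh ?actM -?actM ?mulVg ?act1 //.
by rewrite -[g]mulg1 -salvetti_act_cube mulg1; exists y.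
Qed.

End Points.

(** * Stabilisers of cubes when the image of [phi] lies in [O] *)

Section CubeStabiliser.
Variables (R : realType) (S : finType) (E : rel S) (U : topologicalGroupType)
  (O : openSubgroup U) (phi : openMono O).
Hypothesis phiO : phi @` (O : set U) `<=` O.
Local Notation base := (raag_base E phi).
Local Notation gen := (raag_gen E phi).
Local Notation elt := (clique_elt E phi).

Lemma iter_omono_sub n w : (O : set U) w -> (O : set U) (iter n phi w).
Proof. by move=> Ow; elim: n => [//|n ih] /=; apply: phiO; exists (iter n phi w). Qed.

(** Moving the base element past one generator strips off one application of [phi]; the bound on
    [size s] ensures that enough applications are available. *)
Lemma base_prod_gen (s : seq S) n w : (O : set U) w -> (size s <= n)%N ->
  base (iter n phi w) * \prod_(t <- s) gen t =
  \prod_(t <- s) gen t * base (iter (n - size s) phi w).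
Proof.
move=> Ow; elim: s n => [|t s ih] [|n]//= sn; rewrite ?big_nil ?mulg1 ?mul1g//.
rewrite big_cons /= mulgA -raag_gen_base; last exact: iter_omono_sub.
by rewrite -!mulgA ih.
Qed.

(* Each pinch [u t = t v] shows that [u] is in the image of [phi]; the prefixes of [s]
   provide as many pinches as [s] has letters. *)
Lemma prod_gen_base_iter (s : seq S) u : (0 < size s)%N ->
  (forall n, exists v, base u * \prod_(t <- take n s) gen t =
                       \prod_(t <- take n s) gen t * base v) ->
  exists2 w, (O : set U) w & u = iter (size s) phi w.
Proof.
elim: s u => [//|t s ih] u _ pinch.
have [v] := pinch 1%N; rewrite /= take0 big_seq1 => e.
have [Ov uv] := raag_pinch e.
(* A single letter gives the witness [v] at once. Otherwise the induction continues with [v]: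
   cancelling [t] turns prefixes of [t :: s] into prefixes of [s]. *)
have [s0|] := posnP (size s); first by exists v; rewrite // s0.
move=> /(ih v)[|w Ow vw]; last by exists w => //; rewrite uv vw.
move=> n; have [v' e'] := pinch n.+1; exists v'; move: e'.
by rewrite /= !big_cons /= mulgA e -!mulgA => /mulgI.
Qed.

Lemma stab_cube_iter (g : raag E phi) (T : {set S}) : clique E T -> (0 < #|T|)%N ->
  stab (@salvetti_act R S E U O phi) (cube R g T) =
  conj_set g (base @` (iter #|T| phi @` (O : set U))).
Proof.
move=> cT T0; apply/seteqP; split=> [h sh|_ [_ [_ [w Ow <-] <-] <-]].
  have fix_ (B : {set S}) : B \subset T -> exists v, h * (g * elt B) = g * elt B * base v.
    move=> BT; apply/cosetP/(vertex_eqP R); rewrite -(salvetti_act_vertex R h).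
    exact: sh (cube_vertex R g cT BT).
  have [u hu] := fix_ _ (finset.sub0set T).
  rewrite clique_elt0 mulg1 in hu.
  have [||w Ow uw] := @prod_gen_base_iter (enum T) u.
  - by rewrite -cardE.
  - move=> n; have sT : {subset take n (enum T) <= T}.
      by move=> t /mem_take; rewrite mem_enum.
    have us : uniq (take n (enum T)) by rewrite take_uniq// enum_uniq.
    rewrite -(clique_elt_seq phi cT us sT).
    (* The first [n] elements of [T] span a vertex of the cube; that [h] fixes it gives the equation
       for the prefix of length [n]. *)
    have [|v hv] := fix_ [set t in take n (enum T)]%SET.
      by apply/fintype.subsetP => t; rewrite inE => /sT.
    exists v; apply: (@mulgI _ g).
    by rewrite !mulgA -hu -[LHS]mulgA hv.
  - exists (base u); last by rewrite -hu mulgK.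
    by exists u => //; exists w; rewrite // cardE.
move=> _ [p [pg pT] <-]; rewrite salvetti_actE.
(* The translated cube has the same vertex set as the original, so points with equal coordinates are
   glued. *)
apply/clsP/rst_step/glue_cell => //.
rewrite [pt_type (act_pt _ _)]pT pT; apply: eq_cell => B BT.
rewrite [pt_base (act_pt _ _)](congr1 ( *%g _) pg) pg.
(* Passing the generators of [B] uses up one application of [phi] for each of them. *)
apply/cosetP; exists (iter (#|T| - #|B|) phi w).
rewrite mulgVK -!mulgA; congr (_ * _).
have -> : elt B = \prod_(t <- enum B) gen t.
  rewrite -(clique_elt_seq phi cT) ?enum_uniq ?set_enum// => t.
  by rewrite mem_enum; exact: fintype.subsetP.
by rewrite base_prod_gen -?cardE//; exact: subset_leq_card.
Qed.

End CubeStabiliser.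

(** * Topological isomorphisms with conjugates of images in the RAAG *)

Lemma top_isomorphic_image (G1 G2 : topologicalGroupType) (K : set G2) (F : G2 -> G1) :
  open K -> (forall x y, K x -> K y -> F (x * y) = F x * F y) ->
  (forall x y, K x -> K y -> K (x * y)) ->
  (forall x y, K x -> K y -> F x = F y -> x = y) ->
  (forall x, K x -> {for x, continuous F}) ->
  (forall V, open V -> V `<=` K -> open (F @` V)) ->
  top_isomorphic (F @` K) K.
Proof.
move=> oK FM KM Finj Fc Fo.
(* The inverse of [F] on the image of [K], with default value 1 elsewhere. *)
pose f x := xget 1 [set w | K w /\ F w = x].
have fK w : K w -> f (F w) = w.
  move=> Kw; rewrite /f; case: xgetP => [x _ [Kx]|/(_ w)[]//].
  exact: Finj.
exists f, F; split; first split.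
- by move=> _ [w Kw <-] /=; rewrite fK.
- by move=> w Kw; exists w.
- by move=> _ [w Kw <-]; rewrite fK.
- exact: fK.
- by move=> _ _ [w Kw <-] [v Kv <-]; rewrite -FM// !fK//; exact: KM.
(* The image of [K] is open, so continuity can be tested at its points; there [F] carries
   neighbourhoods inside [K] to neighbourhoods, which is continuity of the inverse. *)
- rewrite continuous_open_subspace; last exact: Fo.
  move=> _ /set_mem[w Kw <-] W; rewrite fK// nbhsE => -[V [oV Vw] VW].
  rewrite nbhsE; exists (F @` (V `&` K)).
    by split; [apply: Fo; [exact: openI|by move=> x []]|exists w].
  by move=> _ [v [Vv Kv] <-] /=; rewrite fK//; exact: VW.
- rewrite continuous_open_subspace// => w /set_mem; exact: Fc.
Qed.

Section TopologicalBase.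
Variables (S : finType) (E : rel S) (U : topologicalGroupType)
  (O : openSubgroup U) (phi : openMono O).
Local Notation base := (raag_base E phi).

Lemma raag_base_continuous : continuous base.
Proof.
move=> u; apply: (@continuous_comp _ _ _ (hnn_base S phi) (@raag_proj S E U O phi)).
  by move: u; apply/continuousP; have [_ + _] := hnn_openP S phi; apply.
exact: raag_proj_continuous.
Qed.

Lemma raag_base_open V : open V -> open (base @` V).
Proof.
move=> oV; have [_ _ ho] := hnn_openP S phi.
have -> : base @` V = @raag_proj S E U O phi @` (hnn_base S phi @` V) by rewrite image_comp.
by apply: raag_proj_open; exact: ho.
Qed.

Lemma conj_base_continuous (g : raag E phi) : continuous (fun u => g * base u * g^-1).
Proof.
move=> u; apply: (@continuous_comp _ _ _ (fun u => g * base u) (fun h => h * g^-1)).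
  apply: (@continuous_comp _ _ _ base ( *%g g)); first exact: raag_base_continuous.
  exact: lmulg_continuous.
exact: rmulg_continuous.
Qed.

Lemma conj_base_open (g : raag E phi) V : open V -> open [set g * base u * g^-1 | u in V].
Proof.
move=> oV; rewrite (_ : [set _ | _ in _] = (fun h => h * g) @^-1` ( *%g g @` (base @` V))).
  apply: open_comp; first by move=> h _; exact: rmulg_continuous.
  by apply: open_lmulg; exact: raag_base_open.
apply/seteqP; split=> [_ [u Vu <-]|h [_ [u Vu <-] e]] /=.
  by exists (base u); [exists u|rewrite mulgVK].
by exists u; rewrite // e mulgK.
Qed.

Lemma conj_baseM (g : raag E phi) :
  {morph (fun u => g * base u * g^-1) : u v / u * v}.
Proof. by move=> u v; rewrite raag_baseM !mulgA mulgVK. Qed.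

Lemma conj_base_inj (g : raag E phi) : injective (fun u => g * base u * g^-1).
Proof. by move=> u v /mulIg/mulgI/raag_base_inj. Qed.

Lemma conj_set_base (g : raag E phi) (V : set U) :
  conj_set g (base @` V) = [set g * base u * g^-1 | u in V].
Proof. by rewrite /conj_set image_comp. Qed.

Lemma top_isomorphic_conj_base (g : raag E phi) :
  top_isomorphic (conj_set g (base @` setT)) [set: U].
Proof.
rewrite conj_set_base; apply: top_isomorphic_image => //.
- exact: openT.
- by move=> u v _ _; exact: conj_baseM.
- by move=> u v _ _; exact: conj_base_inj.
- by move=> u _; exact: conj_base_continuous.
- by move=> V oV _; exact: conj_base_open.
Qed.

Hypothesis phiO : phi @` (O : set U) `<=` O.

(** The values of [phi] outside [O] are arbitrary, so the facts about iterates rest on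
    [iter_omono_sub], which keeps every iterate in [O]. *)
Lemma iter_omonoM n u v : (O : set U) u -> (O : set U) v ->
  iter n phi (u * v) = iter n phi u * iter n phi v.
Proof.
move=> Ou Ov; elim: n => [//|n ih] /=.
by rewrite ih omonoM//; exact: iter_omono_sub.
Qed.

Lemma iter_omono_inj n u v : (O : set U) u -> (O : set U) v ->
  iter n phi u = iter n phi v -> u = v.
Proof.
move=> Ou Ov; elim: n => [//|n ih] /= /omono_inj e.
by apply/ih/e; exact: iter_omono_sub.
Qed.

Lemma iter_omono_continuous n u : (O : set U) u -> {for u, continuous (iter n phi)}.
Proof.
move=> Ou; elim: n => [|n ih]; first exact: cvg_id.
apply: (@continuous_comp _ _ _ (iter n phi) phi) => //.
have := @omono_continuous _ _ phi.
rewrite continuous_open_subspace; last exact: osubg_open.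
by apply; apply/mem_set; exact: iter_omono_sub.
Qed.

Lemma iter_omono_open n V : open V -> V `<=` O -> open (iter n phi @` V).
Proof.
move=> oV VO; elim: n => [|n ih]; first by rewrite image_id.
rewrite -(image_comp (iter n phi) phi); apply: omono_open => // _ [v Vv <-].
by apply: iter_omono_sub => //; exact: VO.
Qed.

Lemma top_isomorphic_conj_base_iter (g : raag E phi) n :
  top_isomorphic (conj_set g (base @` (iter n phi @` (O : set U)))) (O : set U).
Proof.
rewrite conj_set_base image_comp; apply: top_isomorphic_image.
- exact: osubg_open.
- by move=> u v Ou Ov /=; rewrite iter_omonoM// conj_baseM.
- exact: osubgM.
- by move=> u v Ou Ov /conj_base_inj; exact: iter_omono_inj.
- move=> u Ou; apply: (@continuous_comp _ _ _ (iter n phi)).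
    exact: iter_omono_continuous.
  exact: conj_base_continuous.
- move=> V oV VO; rewrite -image_comp; apply: conj_base_open.
  exact: iter_omono_open.
Qed.

End TopologicalBase.

(** * Compactness of cubes and cocompactness of the action *)

Lemma ler_sqr_norm (R : realDomainType) (a b : R) : (`|a| <= `|b| -> a ^+ 2 <= b ^+ 2)%R.
Proof.
move=> ab; rewrite -(real_normK (num_real a)) -(real_normK (num_real b)).
by rewrite lerXn2r ?nnegrE ?normr_ge0.
Qed.

Lemma dist_clamp (R : realDomainType) (a b : R) :
  (`|Num.max 0 (Num.min a 1) - Num.max 0 (Num.min b 1)| <= `|a - b|)%R.
Proof.
have ab := ler_norm (a - b)%R; have := ler_norm (b - a)%R; rewrite distrC => ba.
rewrite ler_norml; case: (lerP 0 (Num.min a 1))%R; case: (lerP 0 (Num.min b 1))%R;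
  case: (lerP a 1) => a1; case: (lerP b 1) => b1; move=> b0 a0; apply/andP; split; lra.
Qed.

Section Cocompact.
Variables (R : realType) (S : finType) (E : rel S) (U : topologicalGroupType)
  (O : openSubgroup U) (phi : openMono O).
Local Notation X := (salvetti R E phi).

(** One segment inside the cube is already a broken line, and clamping does not increase distances.
    This upper bound yields continuity of the parametrisation. *)
Lemma salvetti_dist_cube_pt (g : raag E phi) (T : {set S}) (cT : clique E T) x y :
  (salvetti_dist (cube_pt (R := R) g cT x) (cube_pt g cT y) <= (euclid_dist x y)%:E)%E.
Proof.
pose p z := exist (@is_cube_point R S E U O phi) _ (cube_pt_subproof g z cT).
have sxy : segment (cube_pt (R := R) g cT x) (cube_pt g cT y)
    (euclid_dist (pt_coord (p x)) (pt_coord (p y))).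
  by exists (p x), (p y).
apply: (@le_trans _ _ (euclid_dist (pt_coord (p x)) (pt_coord (p y)))%:E).
  apply: ereal_inf_lbound; exists (euclid_dist (pt_coord (p x)) (pt_coord (p y)) + 0)%R.
    exact: string_cons sxy (string_nil _).
  by rewrite addr0.
rewrite lee_fin ler_wsqrtr// ler_sum// => t _; rewrite /pt_coord /= !ffunE.
case: ifPn => _; last by rewrite subrr expr0n /= sqr_ge0.
exact/ler_sqr_norm/dist_clamp.
Qed.

Definition row_ffun (v : 'rV[R]_#|S|) : {ffun S -> R} := [ffun t => v ord0 (enum_rank t)].

Lemma cube_pt_continuous (g : raag E phi) (T : {set S}) (cT : clique E T) :
  continuous (fun v : 'rV[R]_#|S| => cube_pt g cT (row_ffun v) : X).
Proof.
move=> v W /nbhs_ballP[e /= e0 eW]; apply/nbhs_ballP.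
(* Coordinates closer than [d] give Euclidean distance at most [d] times the square root of [#|S|].
   This is below [e] because [#|S|] is less than the square of [#|S|.+1]. *)
pose d := (e / #|S|.+1%:R)%R; have d0 : (0 < d)%R by rewrite divr_gt0.
exists d => //= w [_ vw]; apply: eW; rewrite salvetti_ballE /=.
apply: le_lt_trans (salvetti_dist_cube_pt _ _ _ _) _; rewrite lte_fin.
rewrite -[ltRHS]gtr0_norm// -sqrtr_sqr ltr_sqrt ?exprn_gt0//.
apply: (@le_lt_trans _ _ (\sum_(t : S) d ^+ 2)%R).
  apply: ler_sum => t _; rewrite !ffunE; apply: ler_sqr_norm.
  by rewrite [leRHS]gtr0_norm//; apply: ltW; have := vw ord0 (enum_rank t).
rewrite sumr_const -mulr_natl /d expr_div_n mulrCA -ltr_pdivlMl ?exprn_gt0//.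
rewrite mulVf ?gt_eqF ?exprn_gt0// ltr_pdivrMr ?exprn_gt0// mul1r.
rewrite -natrX ltr_nat; apply: (@leq_ltn_trans #|S|); first exact: max_card.
by rewrite -mulnn leq_pmulr.
Qed.

Lemma cube_compact (g : raag E phi) (T : {set S}) :
  clique E T -> compact (cube R g T : set X).
Proof.
move=> cT; rewrite (cube_cube_pt R _ cT).
(* Clamping is idempotent, so the cube is already the image of the compact box of all vectors with
   coordinates in the unit interval, including those indexed outside [T]. *)
have -> : range (cube_pt g cT : _ -> X) = (fun v => cube_pt g cT (row_ffun v)) @`
    [set v : 'rV[R]_#|S| | forall i, `[0%R, 1%R]%classic (v ord0 i)].
  apply/seteqP; split=> [_ [x _ <-]|_ [v _ <-]]; last by exists (row_ffun v).
  exists (\row_i Num.max 0 (Num.min (x (enum_val i)) 1))%R.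
    move=> i; rewrite /= mxE in_itv /= le_max lexx /= ge_max ler01 /=.
    by rewrite ge_min lexx orbT.
  congr pt; apply: cube_point_eq => //; apply/ffunP => t; rewrite !ffunE.
  rewrite mxE enum_rankK; case: ifPn => // _.
  rewrite [Num.min (Num.max _ _) _]min_l; last by rewrite ge_max ler01 ge_min lexx orbT.
  by rewrite max_r// le_max lexx.
apply: continuous_compact.
  by apply: continuous_subspaceT; exact: cube_pt_continuous.
exact (@rV_compact R #|S| (fun=> `[0%R, 1%R]%classic) (fun=> @segment_compact R 0%R 1%R)).
Qed.

Lemma salvetti_act_cocompact : cocompact (@salvetti_act R S E U O phi).
Proof.
(* There are finitely many cliques because [S] is finite, and each point is the translate, by its
   base, of a point in the cube of its type at 1. *)
exists (\bigcup_(T in [set` clique E]) cube R 1 T); split.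
  rewrite bigcup_pred; apply: (big_ind compact); first exact: compact0.
    exact: compactU.
  by move=> T; exact: cube_compact.
apply/seteqP; split=> // x _; elim/salvetti_ind: x => p.
exists (pt_base p) => //.
have : cube R (pt_base p * 1) (pt_type p) (pt p) by exists p; rewrite ?mulg1.
rewrite -salvetti_act_cube => -[x Tx <-]; exists x => //.
by exists (pt_type p) => //=; exact: pt_type_clique.
Qed.

End Cocompact.

Theorem proposition5p4 (R : realType) (S : finType) (E : rel S)
    (U : topologicalGroupType) (O : openSubgroup U) (phi : openMono O)
    (E_sym : symmetric E) (E_irr : irreflexive E) (S_neq0 : (0 < #|S|)%N)
    (U_hausdorff : hausdorff_space U) :
  exists act : raag E phi -> salvetti R E phi -> salvetti R E phi,
    [/\ is_action act,
        (forall h g : raag E phi, act h (vertex R g) = vertex R (h * g)),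
        (forall (h : raag E phi) (p q : salvetti R E phi),
           salvetti_dist (act h p) (act h q) = salvetti_dist p q)
      & [/\ (forall T : {set S}, clique E T -> transitive_on act (cubes R E phi T)),
            cocompact act,
            (forall g : raag E phi,
               stab act [set vertex R g] = conj_set g (raag_base E phi @` [set: U]) /\
               top_isomorphic (stab act [set vertex R g]) [set: U])
          & forall (T : {set S}) (g : raag E phi),
              clique E T -> (1 <= #|T|)%N ->
              stab act (cube R g T) = conj_set g (stab act (cube R 1 T)) /\
              (phi @` (O : set U) `<=` O ->
                 stab act (cube R g T) =
                   conj_set g (raag_base E phi @` (iter #|T| phi @` (O : set U))) /\
                 top_isomorphic (stab act (cube R g T)) (O : set U))]].
Proof.
exists (@salvetti_act R S E U O phi); split.
- exact: salvetti_act_action.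
- exact: salvetti_act_vertex.
- exact: salvetti_act_isometry.
split=> [T _||g|T g cT T0].
- exact: salvetti_act_transitive.
- exact: salvetti_act_cocompact.
- by rewrite stab_vertex; split=> //; exact: top_isomorphic_conj_base.
- split=> [|phiO]; first exact: stab_cube.
  by rewrite stab_cube_iter//; split=> //; exact: top_isomorphic_conj_base_iter.
Qed.
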